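(* Fix a constant $K\ge1$. The bounded CQCA prediction problem — given a ternary string $\alpha\in\{0,1,2\}^*$ of length $n$ and a position $(x,y)\in\mathbb{Z}^2$ with $\max(|x|,|y|)\le Kn$ (coordinates given in binary), output the state $c_\infty[\alpha](x,y)\in\Sigma$ — is in the complexity class P and is not in (uniform) AC$^0$.
   Context: AC$^0$ is the class of problems solved by uniform families of constant-depth, polynomial-size Boolean circuits with unbounded fan-in gates. Notation: $E=(1,0)$, $W=(-1,0)$, $N=(0,1)$, $S=(0,-1)$ in $\mathbb{Z}^2$; $[P]\in\{0,1\}$ equals $1$ iff $P$ holds. Strings are indexed from the right. Base $3'$ symbols $0,\bar0,1,\bar1$ are identified with the cell states $(0,0),(0,1),(1,0),(1,1)$. The encoding $\mathrm{enc}:\{0,1,2\}^*\to\{0,\bar0,1,\bar1\}^*$ acts symbol by symbol: $0\mapsto0$, $2\mapsto\bar1$, and a digit $\alpha_i=1$ maps to $1$ if there exists $j<i$ with $\alpha_j\ne1$ and the largest such $j$ has $\alpha_j=2$, and to $\bar0$ otherwise. The CQCA. State set $\Sigma=\{0,1,\bot\}^2\setminus\{(\bot,0),(\bot,1)\}$; a state $(s,c)$ has sum bit $s$ and carry bit $c$; it is undefined if $(\bot,\bot)$, half-defined if $s\in\{0,1\},c=\bot$, defined if $s,c\in\{0,1\}$. One step $F(C)$ of a configuration $C:\mathbb{Z}^2\to\Sigma$: first the non-local rule gives $C'$: $C'(u)=(0,1)$ if $C(u+W)=(1,\bot)$, $C(u)\in\{(0,\bot),(\bot,\bot)\}$ and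 $C(u+iE)\in\{(0,\bot),(\bot,\bot)\}$ for all $i\ge1$; otherwise $C'(u)=C(u)$. Then the local rule on $C'$ at all cells simultaneously: (i) if $C'(u)=(s,\bot)$ half-defined and $C'(u+E)=(s',c')$ defined, $F(C)(u)=(s,[s+s'+c'\ge2])$; (ii) if $C'(u)=(\bot,\bot)$, $C'(u+N)=(s,\bot)$ half-defined and $C'(u+N+E)=(s',c')$ defined, $F(C)(u)=((s+s'+c')\bmod2,\bot)$; (iii) otherwise $F(C)(u)=C'(u)$. For $\alpha\in\{0,1,2\}^*$ with $\gamma=\mathrm{enc}(\alpha)$, the initial configuration $c_0[\alpha]$ is: $c_0[\alpha](0,i)=\gamma_{i-1}$ for $1\le i\le|\alpha|$, $c_0[\alpha](x,|\alpha|)=(0,\bot)$ for all $x<0$, and $(\bot,\bot)$ elsewhere. Each cell's state in $F^i(c_0[\alpha])$ is eventually constant; $c_\infty[\alpha]$ is the pointwise limit. *)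

(* Defs.v *)
From HB Require Import structures.
From mathcomp Require Import all_boot all_order all_algebra.
From mathcomp Require Import reals.
From Stdlib Require Import ClassicalEpsilon.
Set Implicit Arguments. Unset Strict Implicit. Unset Printing Implicit Defensive.
Import Order.TTheory GRing.Theory Num.Theory.
Local Open Scope ring_scope.

(* Cell states  Sigma = {0,1,bot}^2 \ {(bot,0),(bot,1)}                *)
(*   Undef      = (bot,bot)                                            *)
(*   Half s     = (s,bot)      (half-defined)                          *)
(*   Def s c    = (s,c)        (defined)                               *)
Inductive sigma := Undef | Half (s : bool) | Def (s c : bool).

Definition config := int -> int -> sigma.

Definition zero_or_undef (st : sigma) : Prop := st = Half false \/ st = Undef.

Definition nonlocal_cond (C : config) (x y : int) : Prop :=
  C (x - 1) y = Half true /\ zero_or_undef (C x y) /\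
  (forall i : nat, (0 < i)%N -> zero_or_undef (C (x + i%:Z) y)).

Definition nonlocal (C : config) : config := fun x y =>
  if excluded_middle_informative (nonlocal_cond C x y) then Def false true
  else C x y.

Definition local (C' : config) : config := fun x y =>
  match C' x y, C' (x + 1) y with
  | Half s, Def s' c' => Def s (2 <= s + s' + c')%N
  | Undef, _ =>
      match C' x (y + 1), C' (x + 1) (y + 1) with
      | Half s, Def s' c' => Half (odd (s + s' + c'))
      | _, _ => Undef
      end
  | st, _ => st
  end.

Definition F (C : config) : config := local (nonlocal C).

(* Ternary strings: alpha : seq 'I_3 with alpha_i = nth ord0 alpha i,  *)
(* i.e. the list is the string read from the right (index 0 = the      *)
(* rightmost digit).  |alpha| = size alpha.                            *)
Definition digit (alpha : seq 'I_3) (i : nat) : nat := nth ord0 alpha i.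

Fixpoint prev_non1 (alpha : seq 'I_3) (i : nat) : option nat :=
  match i with
  | 0 => None
  | j.+1 => if (digit alpha j != 1)%N then Some (digit alpha j)
            else prev_non1 alpha j
  end.

(* enc : base-3' symbols 0, bar0, 1, bar1 = (0,0),(0,1),(1,0),(1,1) *)
Definition enc (alpha : seq 'I_3) (i : nat) : sigma :=
  match digit alpha i with
  | 0%N => Def false false
  | 1%N => if prev_non1 alpha i == Some 2%N then Def true false
         else Def false true
  | _ => Def true true
  end.

Definition c0 (alpha : seq 'I_3) : config := fun x y =>
  let n := size alpha in
  if (x == 0) && (0 < y) && (y <= n%:Z) then enc alpha (absz (y - 1))
  else if (x < 0) && (y == n%:Z) then Half false
  else Undef.

Definition cinf (alpha : seq 'I_3) (x y : int) (st : sigma) : Prop :=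
  exists T : nat, forall t : nat, (T <= t)%N -> iter t F (c0 alpha) x y = st.

Definition valid_instance (R : realType) (K : R) (alpha : seq 'I_3) (x y : int)
  : Prop :=
  ((absz x)%:R <= K * (size alpha)%:R) /\ ((absz y)%:R <= K * (size alpha)%:R).

Inductive isym := SD0 | SD1 | SD2 | SB0 | SB1 | SMinus | SSep.
Inductive dir := MoveL | MoveR | Stay.

Record TM := {
  tm_Q : finType;
  tm_G : finType;
  tm_blank : tm_G;
  tm_in : isym -> tm_G;
  tm_q0 : tm_Q;
  tm_halt : tm_Q -> option sigma;  (* Some st = halting state with output st *)
  tm_delta : tm_Q -> tm_G -> tm_Q * tm_G * dir
}.

Definition dir_int (d : dir) : int :=
  match d with MoveL => -1 | MoveR => 1 | Stay => 0 end.

Definition tm_config (M : TM) := (tm_Q M * (int -> tm_G M) * int)%type.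

Definition tm_step (M : TM) (cf : tm_config M) : tm_config M :=
  let: (q, tape, pos) := cf in
  match tm_halt q with
  | Some _ => cf
  | None =>
      let: (q', g, d) := tm_delta q (tape pos) in
      (q', (fun z => if z == pos then g else tape z), pos + dir_int d)
  end.

Definition tm_init (M : TM) (w : seq isym) : tm_config M :=
  (tm_q0 M,
   (fun z : int => match z with
                   | Posz k => match drop k w with
                               | a :: _ => tm_in M a
                               | [::] => tm_blank M
                               end
                   | Negz _ => tm_blank M
                   end),
   0%Z).

Definition tm_output (M : TM) (w : seq isym) (t : nat) : option sigma :=
  tm_halt (iter t (@tm_step M) (tm_init M w)).1.1.

Fixpoint bits_lsb (fuel m : nat) : seq bool :=
  match fuel with
  | 0 => [::]
  | f.+1 => if m is 0%N then [::] else odd m :: bits_lsb f m./2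
  end.

Definition nat_bin (m : nat) : seq isym :=
  if (m == 0)%N then [:: SB0]
  else rev (map (fun b : bool => if b then SB1 else SB0) (bits_lsb m m)).

Definition int_bin (z : int) : seq isym :=
  match z with
  | Posz m => nat_bin m
  | Negz m => SMinus :: nat_bin m.+1
  end.

Definition digit_sym (d : 'I_3) : isym :=
  match val d with 0%N => SD0 | 1%N => SD1 | _ => SD2 end.

(* the input word:  alpha (as written, leftmost digit first) # x # y *)
Definition tm_input (alpha : seq 'I_3) (x y : int) : seq isym :=
  map digit_sym (rev alpha) ++ SSep :: int_bin x ++ SSep :: int_bin y.

Definition in_P (R : realType) (K : R) : Prop :=
  exists (M : TM) (c : nat),
    forall alpha x y, valid_instance K alpha x y ->
      exists (t : nat) (st : sigma),
        (t <= (size (tm_input alpha x y)) ^ c + c)%N /\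
        tm_output M (tm_input alpha x y) t = Some st /\ cinf alpha x y st.

(* Boolean circuits with unbounded fan-in AND / OR gates and NOT gates *)
(* A circuit is a list of gates; a gate refers to earlier gates by     *)
(* index (references to non-earlier gates read the constant false);    *)
(* the output is the last gate.                                        *)
Inductive gate := GIn (i : nat) | GNot (j : nat) | GAnd (js : seq nat) | GOr (js : seq nat).

Definition gate_val (inp : nat -> bool) (vals : seq bool) (g : gate) : bool :=
  match g with
  | GIn i => inp i
  | GNot j => ~~ nth false vals j
  | GAnd js => all (fun j => nth false vals j) js
  | GOr js => has (fun j => nth false vals j) js
  end.

Definition circ_vals (inp : nat -> bool) (gs : seq gate) : seq bool :=
  foldl (fun vals g => rcons vals (gate_val inp vals g)) [::] gs.

Definition circ_eval (gs : seq gate) (inp : nat -> bool) : bool :=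
  last false (circ_vals inp gs).

Definition gate_depth (ds : seq nat) (g : gate) : nat :=
  match g with
  | GIn _ => 0
  | GNot j => nth 0 ds j
  | GAnd js | GOr js => (\max_(j <- js) nth 0 ds j).+1
  end.

Definition circ_depths (gs : seq gate) : seq nat :=
  foldl (fun ds g => rcons ds (gate_depth ds g)) [::] gs.

Definition circ_depth (gs : seq gate) : nat := \max_(d <- circ_depths gs) d.

(* Circuit input encoding for instances with |alpha| = n: width
   W n = bit length of ceil(K) * n; bits
     2i, 2i+1        : low / high bit of alpha_i (i < n)
     2n              : sign of x (true iff x < 0)
     2n+1 .. 2n+W    : |x| in binary, least significant bit first
     2n+W+1          : sign of y
     2n+W+2 .. 2n+2W+1 : |y| in binary, least significant bit first
   all other input positions read false. *)
Definition width (R : realType) (K : R) (n : nat) : nat :=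
  (trunc_log 2 (`|Num.ceil K|%N * n)%N).+1.

Definition bitn (m i : nat) : bool := odd (m %/ 2 ^ i)%N.

Definition circ_input (R : realType) (K : R) (alpha : seq 'I_3) (x y : int)
  : nat -> bool := fun k =>
  let n := size alpha in
  let W := width K n in
  if (k < 2 * n)%N then bitn (digit alpha k./2) (odd k)
  else if (k == 2 * n)%N then (x < 0)%R
  else if (k <= 2 * n + W)%N then bitn (absz x) (k - (2 * n).+1)%N
  else if (k == (2 * n + W).+1)%N then (y < 0)%R
  else if (k <= 2 * n + W + W + 1)%N then bitn (absz y) (k - (2 * n + W).+2)%N
  else false.

(* the bounded CQCA prediction problem is computed by a (non-uniform)
   family of constant-depth polynomial-size circuits: one circuit per
   input length n and per output state st, recognising "output = st". *)
Definition in_AC0 (R : realType) (K : R) : Prop :=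
  exists (d c : nat) (Cf : nat -> sigma -> seq gate),
    (forall n st, (size (Cf n st) <= n ^ c + c)%N /\ (circ_depth (Cf n st) <= d)%N) /\
    (forall alpha x y st, valid_instance K alpha x y ->
       (circ_eval (Cf (size alpha) st) (circ_input K alpha x y) <-> cinf alpha x y st)).

(* Main.v *)
From HB Require Import structures.
Require Import Defs.
From mathcomp Require Import all_boot all_order all_algebra.
From mathcomp Require Import reals zify ring.
From Stdlib Require Import ClassicalEpsilon FunctionalExtensionality.
Set Implicit Arguments. Unset Strict Implicit. Unset Printing Implicit Defensive.
Import Order.TTheory GRing.Theory Num.Theory.

(* The CQCA has an explicit space-time diagram: activity at the cell (-k, n - j)
   happens only around time j + k, so the timing of the non-local rule is forced,
   and each limit column is a finite-state transduction of the column to its right.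

   P: a sweeping Turing machine keeps one column on its tape, performs one
   transduction per pass, and counts passes by decrementing |y| and |x| in binary.

   Not AC0: for ternary strings with digits 0 and 1 and last digit 0, the cell
   (-1, 1) ends in state (parity of the digits, 0), so the circuits would compute
   PARITY.  Following Razborov and Smolensky, small constant-depth circuits agree
   outside a small set with F_3-polynomials of low degree; if such a polynomial
   agrees with the full character on A, then every function on A has degree at
   most about N/2, so that A cannot be much larger than half of the cube. *)

(** * Space-time diagram *)

(** The obstacle is the premise of the non-local rule, which inspects a whole half-row. It is
    removed by monotonicity: definedness spreads westward along a row, so a cell that is not yet
    defined has only non-defined cells to its east, and these hold [Undef] or the half-defined bit
    0. Firing therefore depends only on a cell and its west neighbour, which is what makes
    finite-state column transductions possible.

    The field F_3 is chosen because parity is linear over F_2, whereas in characteristic 3 the signs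
    1 and -1 differ and parity becomes the character of full degree.

    Counting passes takes polynomial time although the coordinates are binary, because their values
    are at most K times the length of the string. *)

Definition is_def (a : sigma) : bool := if a is Def _ _ then true else false.

(* [q] is the sum bit (if any) of the west neighbour of a cell in state [a]
   that the local rule alone can no longer change: only the non-local rule can
   still fire there. *)
Definition fin_cell (q : option bool) (a : sigma) : sigma :=
  if (q == Some true) && ~~ is_def a then Def false true else a.

Definition new_cell (q : option bool) (a : sigma) : sigma :=
  match q, fin_cell q a with
  | None, _ => Undef
  | Some s, Def s' c' => Def s (2 <= s + s' + c')
  | Some s, _ => Half s
  end.

Definition next_q (q : option bool) (a : sigma) : option bool :=
  match q, fin_cell q a with
  | Some s, Def s' c' => Some (odd (s + s' + c'))
  | _, _ => None
  end.

Fixpoint qrun (a : nat -> sigma) (j : nat) : option bool :=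
  if j is j'.+1 then next_q (qrun a j') (a j') else Some false.

Section Dynamics.
Variable alpha : seq 'I_3.
Let n := size alpha.

(* [column k j] is the state of the cell (-k, n - j) just before the non-local
   rule may fire at it, and [final k j] its limit.  Read from top to bottom,
   column k+1 is a finite-state transduction of column k. *)
Fixpoint column (k : nat) : nat -> sigma :=
  match k with
  | 0 => fun j => if j < n then enc alpha (n - j.+1) else Undef
  | k'.+1 => fun j => new_cell (qrun (column k') j) (column k' j)
  end.

Definition final (k j : nat) : sigma := fin_cell (qrun (column k) j) (column k j).

Lemma enc_def i : is_def (enc alpha i).
Proof. by rewrite /enc; case: (digit alpha i) => [|[|m]] //; case: ifP. Qed.

(** With incoming sum bit 1, [fin_cell] always returns a defined state and the carry follows at
    once; only a sum bit 0 can be left without a carry. *)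
Lemma new_cell_half q a s : new_cell q a = Half s -> s = false /\ ~~ is_def (fin_cell q a).
Proof.
rewrite /new_cell /fin_cell; case: q => [[]|] //=; case: a => [|s'|s' c'] //=; by case.
Qed.

Lemma column_half k j s : column k j = Half s -> s = false.
Proof.
case: k => [|k] /=; last by case/new_cell_half.
case: ifP => // _ e; by have := enc_def (n - j.+1); rewrite e.
Qed.

Lemma column0_half j s : column 0 j <> Half s.
Proof. rewrite /=; case: ifP => // _ e; by have := enc_def (n - j.+1); rewrite e. Qed.

Lemma final_half k j s : final k j = Half s -> column k j = Half s.
Proof. by rewrite /final /fin_cell; case: ifP. Qed.

Lemma column_nondef k j : ~~ is_def (final k j) -> ~~ is_def (column k j).
Proof. by rewrite /final /fin_cell; case: ifP. Qed.

Lemma new_cell_nondef q a s : q = Some s -> ~~ is_def (new_cell q a) -> ~~ is_def (fin_cell q a).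
Proof. by move=> ->; rewrite /new_cell; case: (fin_cell _ _). Qed.

Lemma next_q_nondef q a : ~~ is_def (fin_cell q a) -> next_q q a = None.
Proof. by rewrite /next_q; case: q => // s; case: (fin_cell _ _). Qed.

(** A sum bit is lost only below a cell that ends non-defined. Its east neighbour in that row then
    ends non-defined too, so the eastern column has also lost its sum bit one row below, and a cell
    that receives no sum bit is [Undef]. *)
Lemma qrun_none k j : qrun (column k) j = None ->
  ~~ is_def (column k j) /\ (forall k', k = k'.+1 -> qrun (column k') j = None).
Proof.
elim: j k => [|j IH] k //= e.
have [fd|fnd] := boolP (is_def (final k j)).
  have qn : qrun (column k) j = None.
    move: e fd; rewrite /next_q /final; case: (qrun _ _) => // s; by case: (fin_cell _ _).
  have [nd prev] := IH _ qn.
  move: fd; rewrite /final qn /fin_cell /= => fd; by rewrite fd in nd.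
case: k fnd e => [|k] fnd e.
  split=> //; move: (column_nondef fnd) => /=; case: (ltnP j n); first by rewrite enc_def.
  by move=> nj _; rewrite ltnNge (leq_trans nj).
have qn : next_q (qrun (column k) j) (column k j) = None.
  case eq : (qrun (column k) j) => [s|] //.
  by rewrite -eq; apply: next_q_nondef; apply: (new_cell_nondef eq); exact: (column_nondef fnd).
split; last by move=> k' [<-].
by rewrite /= qn.
Qed.

Lemma final_nondef_right k j : ~~ is_def (column k.+1 j) -> ~~ is_def (final k j).
Proof.
rewrite /= /final => nd; case eq : (qrun (column k) j) => [s|]; first by rewrite -eq; exact: (new_cell_nondef eq).
by rewrite /fin_cell /=; case: (qrun_none eq).
Qed.

(** This disposes of the non-local premise on the eastern half-row: it follows from the state of the
    single cell where the rule may fire. *)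
Lemma final_nondef_le k i j : ~~ is_def (column k j) -> i < k -> ~~ is_def (final i j).
Proof.
elim: k i => // k IH i nd; rewrite ltnS leq_eqVlt => /orP[/eqP->|]; first exact: final_nondef_right.
apply: IH; apply: column_nondef; exact: final_nondef_right.
Qed.

Lemma zero_or_undef_final k j : ~~ is_def (final k j) -> zero_or_undef (final k j).
Proof.
case e : (final k j) => [|s|] // _; [by right|left].
by rewrite (column_half (final_half e)).
Qed.

Lemma zero_or_undef_column k j : ~~ is_def (column k j) -> zero_or_undef (column k j).
Proof. by case e : (column k j) => [|s|] // _; [right|left; rewrite (column_half e)]. Qed.

Lemma zero_or_undef_nondef a : zero_or_undef a -> ~~ is_def a.
Proof. by case=> ->. Qed.

(** * Evolution in time of the wave front *)

Definition pre_cell (k j : nat) : sigma :=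
  if qrun (column k) j is Some s then Half s else Undef.

(* The computation is a wave front: the cell (-k, n - j) can receive its sum
   bit only at time j + k - 1, its carry one step later, and the non-local rule
   can fire at it only in the step after that. *)
Definition cell_at (t k j : nat) : sigma :=
  match k with
  | 0 => if j < t then final 0 j else column 0 j
  | k'.+1 => if t < j + k' then (if j == 0 then Half false else Undef)
             else if t == j + k' then pre_cell k' j
             else if t == (j + k').+1 then column k j else final k j
  end.

(* [cell_at t] after the non-local half of the step. *)
Definition mid_cell (t k j : nat) : sigma :=
  match k with
  | 0 => if j <= t then final 0 j else column 0 j
  | k'.+1 => if t < j + k' then (if j == 0 then Half false else Undef)
             else if t == j + k' then pre_cell k' j else final k j
  end.

Definition embed (f : nat -> nat -> sigma) : config := fun x y =>
  if (0 < x)%R || (n%:Z < y)%R then Undef else f (absz x) (absz (n%:Z - y)%R).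

Variant coord_spec (x y : int) : Type :=
  | CoordOut of (0 < x)%R || (n%:Z < y)%R : coord_spec x y
  | CoordIn k j of x = (- k%:Z)%R & y = (n%:Z - j%:Z)%R : coord_spec x y.

Lemma coordP x y : coord_spec x y.
Proof.
case: (boolP ((0 < x)%R || (n%:Z < y)%R)) => h; first exact: CoordOut.
by apply: (@CoordIn x y (absz x) (absz (n%:Z - y)%R)); lia.
Qed.

Lemma embed_out f x y : (0 < x)%R || (n%:Z < y)%R -> embed f x y = Undef.
Proof. by rewrite /embed => ->. Qed.

Lemma embed_in f x y k j : x = (- k%:Z)%R -> y = (n%:Z - j%:Z)%R -> embed f x y = f k j.
Proof.
move=> -> ->; rewrite /embed.
have -> : (0 < - k%:Z)%R || (n%:Z < n%:Z - j%:Z)%R = false by lia.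
by congr f; lia.
Qed.

Lemma cell_at0_half t j s : cell_at t 0 j <> Half s.
Proof. by rewrite /cell_at; case: ifP => _ e; apply: (@column0_half j s) => //; exact: final_half. Qed.

(** The west neighbour can show [Half true] at one instant only: earlier it is in its initial state,
    and later every half-defined state carries the bit 0. *)
Lemma nonlocal_cond_cell_at t k j :
  nonlocal_cond (embed (cell_at t)) (- k%:Z)%R (n%:Z - j%:Z)%R <->
  [/\ t = j + k, qrun (column k) j = Some true & ~~ is_def (column k j)].
Proof.
have stk : t = j + k -> cell_at t k j = column k j.
  by move=> ->; case: k => [|k] /=; [rewrite addn0 ltnn | rewrite addnS ltnNge leqnSn /= gtn_eqF // eqxx].
rewrite /nonlocal_cond (@embed_in _ (- k%:Z - 1)%R _ k.+1 j) //; last by lia.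
rewrite (@embed_in _ (- k%:Z)%R _ k j) //.
split.
- case=> e [z _]; suff [tE q1] : t = j + k /\ qrun (column k) j = Some true.
    by split=> //; move: z; rewrite stk // => /zero_or_undef_nondef.
  move: e; rewrite [cell_at _ _ _]/cell_at; case: ltnP => h; first by case: (j == 0).
  case: eqP => [-> | _]; first by rewrite /pre_cell; case: (qrun _ _) => // s [->].
  by case: eqP => _ => [|/final_half] /column_half.
- case=> tE q1 nd; rewrite stk //; split; first by rewrite /cell_at -tE ltnn eqxx /pre_cell q1.
  split; first exact: zero_or_undef_column.
  (* East of column 0 everything is [Undef]; in the columns between, the wave has already passed and
     the final states apply. *)
  move=> i i0; have [ik|ki] := leqP i k; last by rewrite embed_out; [right | lia].
  rewrite (@embed_in _ _ _ (k - i) j) //; last by lia.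
  have lt : k - i < k by lia.
  have := zero_or_undef_final (final_nondef_le nd lt).
  rewrite /cell_at; case e : (k - i) => [|m]; first by have -> : j < t by lia.
  have -> : t < j + m = false by lia.
  have -> : t == j + m = false by lia.
  by case: eqP => // tm; lia.
Qed.

Variant nonlocal_spec (C : config) x y : sigma -> Prop :=
  | NonlocalFire of nonlocal_cond C x y : nonlocal_spec C x y (Def false true)
  | NonlocalKeep of ~ nonlocal_cond C x y : nonlocal_spec C x y (C x y).

Lemma nonlocalP C x y : nonlocal_spec C x y (nonlocal C x y).
Proof.
by rewrite /nonlocal; case: excluded_middle_informative => h; constructor.
Qed.

Lemma nonlocal_cell_at t : nonlocal (embed (cell_at t)) = embed (mid_cell t).
Proof.
apply: functional_extensionality => x; apply: functional_extensionality => y.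
case: (coordP x y) => [out|k j -> ->].
  case: nonlocalP => [[e _]|_]; rewrite !embed_out //.
  case: (coordP (x - 1)%R y) => [out'|k j ex ey]; first by rewrite embed_out in e.
  move: e; rewrite (embed_in _ ex ey); case: k ex => [|k] ex; first by move/cell_at0_half.
  by lia.
rewrite [RHS](@embed_in _ (- k%:Z)%R _ k j) //.
case: nonlocalP => [/nonlocal_cond_cell_at[tE q nd]|H].
  have fE : final k j = Def false true by rewrite /final /fin_cell q nd.
  rewrite /mid_cell -fE; case: k tE {q nd} fE => [|k] -> _ /=; first by rewrite addn0 leqnn.
  have -> : j + k.+1 < j + k = false by lia.
  by have -> : j + k.+1 == j + k = false by lia.
have fE : t = j + k -> final k j = column k j.
  move=> tE; rewrite /final /fin_cell; case: ifP => // /andP[/eqP q nd].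
  by case: H; apply/nonlocal_cond_cell_at.
rewrite (@embed_in _ (- k%:Z)%R _ k j) //.
rewrite /cell_at /mid_cell; case: k {H} fE => [|k] fE.
  case: ltngtP => // tE; by rewrite fE //; lia.
case: ltnP => // _; case: eqP => // _; case: eqP => // tE; by rewrite fE // tE addnS.
Qed.

(** Behind the wave a half-defined cell has a non-defined east neighbour, so it triggers neither the
    carry rule in its own row nor the sum rule in the row below. *)
Lemma mid_half_fin t k j s : j + k < t -> mid_cell t k.+1 j = Half s -> ~~ is_def (mid_cell t k j).
Proof.
move=> lt; rewrite {1}/mid_cell ltnNge (ltnW lt) /= gtn_eqF // => /final_half e.
have nd : ~~ is_def (final k j) by apply: final_nondef_right; rewrite e.
case: k lt nd {e} => [|k] lt nd /=; first by have -> : j <= t by lia.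
have -> : t < j + k = false by lia.
by have -> : t == j + k = false by lia.
Qed.

Lemma mid_fin t k j : j + k <= t -> mid_cell t k j = final k j.
Proof.
case: k => [|k] h /=; first by have -> : j <= t by lia.
have -> : t < j + k = false by lia.
by have -> : t == j + k = false by lia.
Qed.

Lemma mid_early t k j : t < j + k -> ~~ is_def (mid_cell t k.+1 j) /\ (forall s, mid_cell t k.+1 j = Half s -> ~~ is_def (mid_cell t k j)).
Proof.
move=> lt; rewrite {1 2}/mid_cell lt; case: eqP => [j0|_] //; split=> // s _.
case: k lt => [|k] lt; first by lia.
rewrite /mid_cell; case: ltnP => // h; first by case: ifP.
have -> : t == j + k by lia.
by rewrite /pre_cell; case: (qrun _ _).
Qed.

(** West of column 0 only two instants matter for the cell [k.+1], [j]: the step ending at time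
    [j + k] brings the sum bit from the row above (in row 0 it is there from the start), and the
    next step brings the carry. Before and after, both local rules are blocked. *)
Lemma local_mid_cell t : local (embed (mid_cell t)) = embed (cell_at t.+1).
Proof.
apply: functional_extensionality => x; apply: functional_extensionality => y.
rewrite /local; case: (coordP x y) => [out|k j -> ->].
  rewrite [embed (mid_cell _) x y]embed_out // [RHS]embed_out //.
  case: (coordP x (y + 1)%R) => [out'|k j ex ey]; first by rewrite embed_out.
  rewrite (embed_in _ ex ey); case: k ex => [|k] ex; last by lia.
  have -> : mid_cell t 0 j = cell_at t.+1 0 j by [].
  by case e : (cell_at t.+1 0 j) => [|s|] //; case: (cell_at0_half e).
rewrite !(@embed_in _ (- k%:Z)%R (n%:Z - j%:Z)%R k j) //.
case: k => [|k].
  have -> : mid_cell t 0 j = cell_at t.+1 0 j by [].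
  case e : (cell_at t.+1 0 j) => [|s|] //.
  case: j e => [|j] e; first by rewrite embed_out //; lia.
  rewrite (@embed_in _ _ _ 0 j) //; last by lia.
  have -> : mid_cell t 0 j = cell_at t.+1 0 j by [].
  by case e' : (cell_at t.+1 0 j) => [|s|] //; case: (cell_at0_half e').
have e1 : (- k.+1%:Z + 1 = - k%:Z)%R by lia.
have up (P : sigma -> sigma -> sigma) : j != 0 -> 
  P (embed (mid_cell t) (- k.+1%:Z)%R (n%:Z - j%:Z + 1)%R) (embed (mid_cell t) (- k.+1%:Z + 1)%R (n%:Z - j%:Z + 1)%R)
  = P (mid_cell t k.+1 j.-1) (mid_cell t k j.-1).
  case: j => // j _; rewrite (@embed_in _ (- k.+1%:Z)%R (n%:Z - j.+1%:Z + 1)%R k.+1 j) //; last by lia.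
  by rewrite (@embed_in _ (- k.+1%:Z + 1)%R (n%:Z - j.+1%:Z + 1)%R k j) //; lia.
rewrite (@embed_in _ (- k.+1%:Z + 1)%R (n%:Z - j%:Z)%R k j) //.
set upm := match embed (mid_cell t) _ (n%:Z - j%:Z + 1)%R with Half _ => _ | _ => _ end.
have upE : upm = if j is j'.+1 then
   match mid_cell t k.+1 j', mid_cell t k j' with Half s, Def s' c' => Half (odd (s + s' + c')) | _, _ => Undef end
   else Undef.
  rewrite /upm; case: j {upm} up => [|j] up; first by rewrite embed_out //; lia.
  exact: (up (fun a b => match a, b with Half s, Def s' c' => Half (odd (s + s' + c')) | _, _ => Undef end)).
rewrite {}upE {upm up e1}.
have [lt|gt|tE] := ltngtP t (j + k).
- have [_ E] := mid_early lt.
  have -> : cell_at t.+1 k.+1 j = if j is j'.+1 then (if t == j' + k then pre_cell k j else Undef) else Half false.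
    rewrite /cell_at; case: j lt {E} => [|j] lt; last first.
      by rewrite addSn ltnS eqSS; case: ltngtP => //; lia.
    by case: ltnP => // h; have -> : t.+1 == 0 + k by lia.
  case: j lt E => [|j] lt E.
    have e : mid_cell t k.+1 0 = Half false by rewrite /mid_cell lt.
    by have := E _ e; rewrite e; case: (mid_cell t k 0).
  have -> : mid_cell t k.+1 j.+1 = Undef by rewrite /mid_cell lt.
  have [tE|tN] := eqVneq t (j + k).
    rewrite tE (@mid_fin _ k j) // /mid_cell ltnn eqxx /pre_cell /= /next_q /final.
    by case: (qrun (column k) j) => // s; case: (fin_cell _ _).
  have lt' : t < j + k by lia.
  have [_ E'] := mid_early lt'.
  by case: (mid_cell t k.+1 j) E' => // s /(_ s erefl); case: (mid_cell t k j).
- rewrite (@mid_fin t k.+1 j); last by lia.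
  rewrite (@mid_fin t k j); last by lia.
  have -> : cell_at t.+1 k.+1 j = final k.+1 j.
    rewrite /cell_at; have -> : t.+1 < j + k = false by lia.
    by rewrite !gtn_eqF //; lia.
  case e : (final k.+1 j) => [|s|] //.
    case: j gt {e} => // j gt.
    have lt' : j + k < t by lia.
    by have := @mid_half_fin t k j _ lt'; case: (mid_cell t k.+1 j) => // s /(_ s erefl); case: (mid_cell t k j).
  have := @final_nondef_right k j; rewrite (final_half e) => /(_ erefl).
  by case: (final k j).
- rewrite (@mid_fin t k j); last by lia.
  have -> : cell_at t.+1 k.+1 j = column k.+1 j.
    by rewrite /cell_at tE ltnNge leqnSn /= eqxx gtn_eqF.
  have -> : mid_cell t k.+1 j = pre_cell k j by rewrite /mid_cell tE ltnn eqxx.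
  rewrite /pre_cell [column k.+1 j]/= /new_cell /final; case q : (qrun (column k) j) => [s|].
    by case: (fin_cell _ _).
  case: j tE q => // j tE q.
  have lt' : j + k < t by lia.
  by have := @mid_half_fin t k j _ lt'; case: (mid_cell t k.+1 j) => // s /(_ s erefl); case: (mid_cell t k j).
Qed.

Lemma c0_cell_at : c0 alpha = embed (cell_at 0).
Proof.
apply: functional_extensionality => x; apply: functional_extensionality => y.
rewrite /c0 -/n; case: (coordP x y) => [out|k j -> ->].
  rewrite embed_out //; case: ifP => [h|_]; first by lia.
  by case: ifP => // h; lia.
rewrite (@embed_in _ _ _ k j) // /cell_at; case: k => [|k].
  rewrite ltn0 oppr0 eqxx [(0 < 0)%R]ltxx andTb andFb.
  have -> : (0 < n%:Z - j%:Z)%R && (n%:Z - j%:Z <= n%:Z)%R = (j < n) by lia.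
  by rewrite [column 0 j]/=; case: ifP => // h; congr (enc alpha _); lia.
have -> : (- k.+1%:Z == 0 :> int)%R = false by lia.
have -> : (- k.+1%:Z < 0 :> int)%R by lia.
have -> : (n%:Z - j%:Z == n%:Z)%R = (j == 0) by lia.
rewrite /=; case: (posnP (j + k)) => [e|_] //.
have -> : j = 0 by lia.
have -> : k = 0 by lia.
by [].
Qed.

Lemma iter_F_cell_at t : iter t F (c0 alpha) = embed (cell_at t).
Proof.
elim: t => [|t IH]; first exact: c0_cell_at.
by rewrite iterS IH /F nonlocal_cell_at local_mid_cell.
Qed.

Lemma cinf_in k j : cinf alpha (- k%:Z)%R (n%:Z - j%:Z)%R (final k j).
Proof.
exists (j + k).+2 => t le; rewrite iter_F_cell_at (@embed_in _ _ _ k j) // /cell_at.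
case: k le => [|k] le; first by have -> : j < t by lia.
have -> : t < j + k = false by lia.
by rewrite !gtn_eqF //; lia.
Qed.

Lemma cinf_out x y : (0 < x)%R || (n%:Z < y)%R -> cinf alpha x y Undef.
Proof. by move=> out; exists 0 => t _; rewrite iter_F_cell_at embed_out. Qed.

Lemma cinf_ex x y : exists s, cinf alpha x y s.
Proof.
case: (coordP x y) => [out|k j -> ->]; first by exists Undef; exact: cinf_out.
by exists (final k j); exact: cinf_in.
Qed.

Lemma cinf_inj x y s s' : cinf alpha x y s -> cinf alpha x y s' -> s = s'.
Proof.
move=> [T H] [T' H']; by rewrite -(H (T + T')) ?leq_addr // H' // leq_addl.
Qed.

End Dynamics.

(** * PARITY is not in AC0 *)

Section Smolensky.
Variable N : nat.
Local Notation cube := {ffun 'I_N -> bool}.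
Local Notation F3 := 'F_3.
Local Open Scope ring_scope.

(** * Degree over F_3, measured in characters *)

Definition chi (S : {set 'I_N}) (x : cube) : F3 := \prod_(i in S) (-1) ^+ x i.

(** Characters are monomials in variables with values 1 and -1. Squares equal 1, so a product of two
    characters is again a character ([chiM]) and no reduction to multilinear form is required. *)
Definition has_deg (d : nat) (f : cube -> F3) : Prop :=
  exists c : {set 'I_N} -> F3, forall x, f x = \sum_(S : {set 'I_N} | (#|S| <= d)%N) c S * chi S x.

Lemma has_deg_ext d f g : f =1 g -> has_deg d f -> has_deg d g.
Proof. by move=> fg [c H]; exists c => x; rewrite -fg. Qed.

Lemma has_deg_leq d d' f : (d <= d')%N -> has_deg d f -> has_deg d' f.
Proof.
move=> le [c H]; exists (fun S : {set 'I_N} => if (#|S| <= d)%N then c S else 0) => x.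
rewrite H big_mkcond [RHS]big_mkcond; apply: eq_bigr => S _.
case: (leqP #|S| d) => h; first by rewrite (leq_trans h le).
by rewrite mul0r if_same.
Qed.

Lemma has_deg_chi d (S : {set 'I_N}) : (#|S| <= d)%N -> has_deg d (chi S).
Proof.
move=> le; exists (fun T : {set 'I_N} => (T == S)%:R) => x; rewrite (bigD1 S) //= eqxx mul1r.
by rewrite big1 ?addr0 // => T /andP[_ /negPf->]; rewrite mul0r.
Qed.

Lemma has_degD d f g : has_deg d f -> has_deg d g -> has_deg d (fun x => f x + g x).
Proof.
move=> [c H] [c' H']; exists (fun S => c S + c' S) => x.
by rewrite H H' -big_split; apply: eq_bigr => S _; rewrite mulrDl.
Qed.

Lemma has_degZ d a f : has_deg d f -> has_deg d (fun x => a * f x).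
Proof.
move=> [c H]; exists (fun S => a * c S) => x.
by rewrite H mulr_sumr; apply: eq_bigr => S _; rewrite mulrA.
Qed.

Lemma has_deg_const d a : has_deg d (fun=> a).
Proof.
apply: (@has_deg_ext _ (fun x => a * chi set0 x)); first by move=> x; rewrite /chi big_set0 mulr1.
by apply: has_degZ; apply: has_deg_chi; rewrite cards0.
Qed.

Lemma has_degB d f g : has_deg d f -> has_deg d g -> has_deg d (fun x => f x - g x).
Proof.
move=> hf hg; apply: (@has_deg_ext _ (fun x => f x + (-1) * g x)); first by move=> x; rewrite mulN1r.
by apply: has_degD => //; apply: has_degZ.
Qed.

Lemma has_deg_sum (I : Type) (r : seq I) (P : pred I) d (f : I -> cube -> F3) :
  (forall i, P i -> has_deg d (f i)) -> has_deg d (fun x => \sum_(i <- r | P i) f i x).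
Proof.
move=> H; elim: r => [|i r IH].
  by apply: (@has_deg_ext _ (fun=> 0)); [move=> x; rewrite big_nil | exact: has_deg_const].
case Pi : (P i); last first.
  by apply: has_deg_ext IH => x; rewrite big_cons Pi.
apply: (@has_deg_ext _ (fun x => f i x + \sum_(i <- r | P i) f i x)); first by move=> x; rewrite big_cons Pi.
by apply: has_degD => //; apply: H.
Qed.

Lemma chiE S x : chi S x = \prod_i (if i \in S then (-1) ^+ x i else 1).
Proof. by rewrite /chi big_mkcond. Qed.

Lemma chiM S T x : chi S x * chi T x = chi ((S :\: T) :|: (T :\: S)) x.
Proof.
rewrite !chiE -big_split; apply: eq_bigr => i _; rewrite !inE.
by case: (i \in S); case: (i \in T); rewrite /= ?mul1r ?mulr1 // -signr_addb addbb.
Qed.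

Lemma has_degM d d' f g : has_deg d f -> has_deg d' g -> has_deg (d + d') (fun x => f x * g x).
Proof.
move=> [c H] [c' H'].
apply: (@has_deg_ext _ (fun x => \sum_(S : {set 'I_N} | (#|S| <= d)%N) \sum_(T : {set 'I_N} | (#|T| <= d')%N)
   (c S * c' T) * chi ((S :\: T) :|: (T :\: S)) x)).
  move=> x; rewrite H H' big_distrl; apply: eq_bigr => S _; rewrite big_distrr.
  by apply: eq_bigr => T _; rewrite -chiM /=; ring.
apply: has_deg_sum => S hS; apply: has_deg_sum => T hT; apply: has_degZ; apply: has_deg_chi.
apply: leq_trans (leq_card_setU _ _) _; apply: leq_add.
  by apply: leq_trans hS; apply: subset_leq_card; apply: subsetDl.
by apply: leq_trans hT; apply: subset_leq_card; apply: subsetDl.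
Qed.

Lemma has_deg_prod (I : Type) (r : seq I) (f : I -> cube -> F3) d :
  (forall i, has_deg d (f i)) -> has_deg (d * size r) (fun x => \prod_(i <- r) f i x).
Proof.
move=> H; elim: r => [|i r IH].
  by apply: (@has_deg_ext _ (fun=> 1)); [move=> x; rewrite big_nil | exact: has_deg_const].
apply: (@has_deg_ext _ (fun x => f i x * \prod_(i <- r) f i x)); first by move=> x; rewrite big_cons.
by rewrite mulnS; apply: has_degM.
Qed.

Lemma signF3 (b : bool) : (-1) ^+ b = 1 + b%:R :> F3.
Proof. by case: b; apply/eqP. Qed.

Lemma has_deg_bit d i : (0 < d)%N -> has_deg d (fun x => (x i)%:R).
Proof.
move=> d0; apply: (@has_deg_ext _ (fun x => chi [set i] x - 1)).
  by move=> x; rewrite /chi big_set1 signF3 addrAC subrr add0r.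
by apply: has_degB; [apply: has_deg_chi; rewrite cards1 | exact: has_deg_const].
Qed.

Lemma has_deg_all (f : cube -> F3) : has_deg N f.
Proof.
apply: (@has_deg_ext _ (fun x => \sum_(a : cube) f a * \prod_(i : 'I_N) (x i == a i)%:R)).
  move=> x; rewrite (bigD1 x) //= big1 ?mulr1; last by move=> i _; rewrite eqxx.
  rewrite big1 ?addr0 // => a ax.
  have [i hi] : exists i, x i != a i.
    apply/existsP; apply: contraR ax; rewrite negb_exists => /forallP H.
    by apply/eqP/ffunP => i; have := H i; rewrite negbK => /eqP.
  by rewrite (bigD1 i) //= (negPf hi) mul0r mulr0.
apply: has_deg_sum => a _; apply: has_degZ.
have eN : (1 * size (index_enum 'I_N) <= N)%N.
  by rewrite mul1n /index_enum -enumT size_enum_ord.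
apply: has_deg_leq eN _; apply: has_deg_prod => i; case: (a i).
  by apply: has_deg_ext (has_deg_bit i (leqnn 1)) => x; case: (x i).
apply: (@has_deg_ext _ (fun x => 1 - (x i)%:R)); first by move=> x; case: (x i); apply/eqP.
by apply: has_degB; [exact: has_deg_const | exact: has_deg_bit].
Qed.

Definition balls (d : nat) : {set {set 'I_N}} := [set S : {set 'I_N} | (#|S| <= d)%N].

(* On [A] every character of a large set is [h] times the character of its
   complement, so all functions on [A] have degree at most [N/2 + d]. *)
Lemma has_deg_half (A : {set cube}) h d (f : cube -> F3) :
  has_deg d h -> {in A, h =1 chi setT} ->
  exists2 g, has_deg (N./2 + d) g & {in A, f =1 g}.
Proof.
move=> hh hA; have [c Hc] := has_deg_all f.
exists (fun x => \sum_(S : {set 'I_N}) c S * (if (#|S| <= N./2)%N then chi S x else h x * chi (~: S) x)).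
  apply: has_deg_sum => S _; apply: has_degZ; case: leqP => hS.
    by apply: has_deg_chi; apply: leq_trans hS (leq_addr _ _).
  rewrite addnC; apply: has_degM => //; apply: has_deg_chi.
  by have := cardsC S; rewrite card_ord; lia.
move=> x xA; rewrite Hc big_mkcond; apply: eq_bigr => S _.
rewrite (leq_trans (max_card _)) ?card_ord //; congr (_ * _); case: ifP => // _.
rewrite hA // chiM; congr chi; apply/setP => i; rewrite !inE; by case: (i \in S).
Qed.

(** A dimension argument carried out by counting: coefficient families supported on the ball map
    onto all functions supported on [A], and comparing the two powers of 3 compares the
    exponents. *)
Lemma card_agree_parity (A : {set cube}) h d :
  has_deg d h -> {in A, h =1 chi setT} -> (#|A| <= #|balls (N./2 + d)|)%N.
Proof.
move=> hh hA.
have inj3 : (3 ^ #|A| <= 3 ^ #|balls (N./2 + d)|)%N; last by rewrite leq_exp2l in inj3.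
pose ev (c : {ffun {set 'I_N} -> F3}) : {ffun cube -> F3} :=
  [ffun x => if x \in A then \sum_(S in balls (N./2 + d)) c S * chi S x else 0].
have card3 : #|{: F3}| = 3%N by rewrite card_Fp.
rewrite -{1 2}card3 -(card_pffun_on 0 (mem A)) -(card_pffun_on 0 (mem (balls (N./2 + d)))).
apply: (@leq_trans #|[seq ev c | c in pffun_on 0 (mem (balls (N./2 + d))) predT]|); last exact: leq_image_card.
apply: subset_leq_card; apply/subsetP => f /pffun_onP[fA _].
have [g [c Hc] fg] := has_deg_half f hh hA.
apply/imageP; exists [ffun S => if S \in balls (N./2 + d) then c S else 0].
  apply/pffun_onP; split; last by [].
  by apply/subsetP => S; rewrite unfold_in /= ffunE; case: ifP => //; rewrite eqxx.
apply/ffunP => x; rewrite ffunE; case: ifP => xA.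
  rewrite fg // Hc; apply: eq_big => [S|S hS]; first by rewrite inE.
  by rewrite ffunE inE hS.
by apply/eqP; apply: contraFT xA => fx; apply: (subsetP fA).
Qed.

(** * Approximating gates by subset sums *)

Definition null_sum k (b : 'I_k -> cube -> bool) (S : {set 'I_k}) (x : cube) : bool :=
  (\sum_(a in S) (b a x)%:R : F3) == 0.

Lemma card_set_ord k : #|{: {set 'I_k}}| = (2 ^ k)%N.
Proof. by rewrite -cardsT -powersetT card_powerset cardsT card_ord. Qed.

(** Fix [x] and some [a] with [b a x]. Toggling [a] in [S] changes the sum by 1, so the null subsets
    are disjoint from their toggled images and number at most half of all subsets. Averaging over
    [S] yields one subset that is null on at most half of [U]. *)
Lemma halving k (b : 'I_k -> cube -> bool) (U : {set cube}) :
  {in U, forall x, exists a, b a x} ->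
  exists S : {set 'I_k}, (2 * #|[set x in U | null_sum b S x]| <= #|U|)%N.
Proof.
move=> hU; pose Z x (S : {set 'I_k}) := null_sum b S x.
have half x : x \in U -> (2 * #|[set S | Z x S]| <= 2 ^ k)%N.
  move=> /hU[a ba]; pose tg (S : {set 'I_k}) := if a \in S then S :\ a else a |: S.
  have tgK : involutive tg.
    move=> S; rewrite /tg; case: (boolP (a \in S)) => h; first by rewrite !inE eqxx /= setD1K.
    by rewrite setU11 setU1K.
  have dis : [disjoint [set S | Z x S] & tg @: [set S | Z x S]].
    rewrite -setI_eq0; apply/eqP/setP => S; rewrite !inE; apply/negbTE/negP => /andP[ZS /imsetP[T]].
    rewrite inE => ZT ST; move: ZS ZT; rewrite ST /Z /null_sum /tg.
    case: (boolP (a \in T)) => aT.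
      rewrite [X in _ -> X == 0 -> _](bigD1 a) //= ba.
      rewrite (eq_bigl (fun i => (i \in T) && (i != a))); last by move=> i; rewrite !inE andbC.
      by move=> /eqP->; rewrite addr0.
    rewrite big_setU1 //= ba => /eqP h /eqP h'; move: h; by rewrite h' addr0 => /eqP.
  have -> : (2 ^ k)%N = #|{: {set 'I_k}}| by rewrite card_set_ord.
  rewrite mul2n -addnn -{2}(card_imset _ (inv_inj tgK)).
  by move: dis; rewrite -leq_card_setU => /eqP <-; apply: max_card.
apply/existsP; apply: contraT; rewrite negb_exists => /forallP H.
have le1 : (\sum_(S : {set 'I_k}) 2 * #|[set x in U | Z x S]| <= #|U| * 2 ^ k)%N.
  have -> : (\sum_(S : {set 'I_k}) 2 * #|[set x in U | Z x S]| = \sum_(x in U) 2 * #|[set S | Z x S]|)%N.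
    rewrite -!big_distrr /=; congr (2 * _)%N.
    under eq_bigr do rewrite -sum1_card.
    under [RHS]eq_bigr do rewrite -sum1_card.
    rewrite (exchange_big_dep (mem U)) /=; last by move=> S x _; rewrite inE => /andP[].
    by apply: eq_bigr => x xU; apply: eq_bigl => S; rewrite !inE xU.
  rewrite -sum_nat_const; apply: leq_sum => x; exact: half.
have : (\sum_(S : {set 'I_k}) (#|U|).+1 <= \sum_(S : {set 'I_k}) 2 * #|[set x in U | Z x S]|)%N.
  by apply: leq_sum => S _; have := H S; rewrite -ltnNge.
move=> /leq_trans/(_ le1); rewrite sum_nat_const card_set_ord mulnC leq_pmul2r ?expn_gt0 //.
by rewrite ltnn.
Qed.

Lemma sqrF3 (s : F3) : s != 0 -> 1 - s ^+ 2 = 0.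
Proof. by case: s => [[|[|[|m]]] i] // _; apply/eqP. Qed.

(* [g] approximates the indicator of "all [b a] are false", with one-sided error. *)
Lemma approx_nor k (b : 'I_k -> cube -> bool) (P : 'I_k -> cube -> F3) (E : {set cube}) d l :
  (forall a, has_deg d (P a)) ->
  (forall a x, x \notin E -> P a x = (b a x)%:R) ->
  exists g : cube -> F3, [/\ has_deg (2 * l * d) g,
    forall x, x \notin E -> ~~ [exists a, b a x] -> g x = 1 &
    (#|[set x | [&& x \notin E, [exists a, b a x] & g x != 0%R]]| * 2 ^ l <= 2 ^ N)%N].
Proof.
move=> hP hb; elim: l => [|l [g [dg g1 gl]]].
  exists (fun=> 1); split=> //; first exact: has_deg_const.
  by rewrite muln1; apply: leq_trans (max_card _) _; rewrite card_ffun card_bool card_ord.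
set U := [set x | _] in gl.
have [S HS] : exists S : {set 'I_k}, (2 * #|[set x in U | null_sum b S x]| <= #|U|)%N.
  by apply: halving => x; rewrite inE => /and3P[_ /existsP].
(* The new subset is chosen for the points where [g] still errs, so each factor halves the error
   set: a nonzero element of F_3 has square 1, hence the factor vanishes wherever the sum is
   nonzero. *)
exists (fun x => g x * (1 - (\sum_(a in S) P a x) ^+ 2)); split.
- have -> : (2 * l.+1 * d = 2 * l * d + (d + d))%N by lia.
  apply: has_degM => //; apply: has_degB; first exact: has_deg_const.
  apply: (@has_deg_ext _ (fun x => (\sum_(a in S) P a x) * (\sum_(a in S) P a x))) => //.
  by apply: has_degM; apply: has_deg_sum.
- move=> x xE nb; rewrite g1 // big1 ?expr0n ?subr0 ?mulr1 // => a _.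
  rewrite hb //; move: nb; rewrite negb_exists => /forallP/(_ a)/negPf -> //.
- rewrite expnS mulnA [(_ * 2)%N]mulnC; apply: leq_trans gl; rewrite leq_mul2r; apply/orP; right.
  apply: leq_trans HS; rewrite leq_mul2l /=; apply: subset_leq_card; apply/subsetP => x.
  rewrite !inE => /and3P[xE bx]; rewrite xE bx mulf_eq0 negb_or => /andP[-> nz] /=.
  apply: contraR nz => nz; rewrite sqrF3 //.
  by rewrite (_ : \sum_(a in S) P a x = \sum_(a in S) (b a x)%:R) //; apply: eq_bigr => a _; rewrite hb.
Qed.

Lemma circ_vals_rcons inp gs g :
  circ_vals inp (rcons gs g) = rcons (circ_vals inp gs) (gate_val inp (circ_vals inp gs) g).
Proof. by rewrite /circ_vals -cats1 foldl_cat. Qed.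

Lemma circ_depths_rcons gs g :
  circ_depths (rcons gs g) = rcons (circ_depths gs) (gate_depth (circ_depths gs) g).
Proof. by rewrite /circ_depths -cats1 foldl_cat. Qed.

Lemma size_circ_vals inp gs : size (circ_vals inp gs) = size gs.
Proof. by elim/last_ind: gs => // gs g IH; rewrite circ_vals_rcons !size_rcons IH. Qed.

Lemma size_circ_depths gs : size (circ_depths gs) = size gs.
Proof. by elim/last_ind: gs => // gs g IH; rewrite circ_depths_rcons !size_rcons IH. Qed.

(** The flag [neg] lets the same construction serve conjunctions, by De Morgan. *)
Lemma approx_or (vals : cube -> seq bool) (P : nat -> cube -> F3) (js : seq nat) (E : {set cube}) d l (neg : bool) :
  (forall j, j \in js -> has_deg d (P j)) ->
  (forall j x, x \notin E -> P j x = (nth false (vals x) j)%:R) ->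
  exists (g : cube -> F3) (E' : {set cube}), [/\ has_deg (2 * l * d) g,
    forall x, x \notin E' -> g x = (has (fun j => neg (+) nth false (vals x) j) js)%:R,
    E \subset E' & (#|E'| * 2 ^ l <= #|E| * 2 ^ l + 2 ^ N)%N].
Proof.
move=> hP hv.
pose b (a : 'I_(size js)) x := neg (+) nth false (vals x) (nth 0%N js a).
pose Q (a : 'I_(size js)) x := if neg then 1 - P (nth 0%N js a) x else P (nth 0%N js a) x.
have [a|a x xE|g [dg g1 gl]] := @approx_nor _ b Q E d l.
- rewrite /Q; have := hP (nth 0%N js a) (mem_nth _ (ltn_ord a)); case: (neg) => // h.
  by apply: has_degB => //; exact: has_deg_const.
- by rewrite /Q /b hv //; case: (neg); case: (nth _ _ _); apply/eqP.
have hasE x : has (fun j => neg (+) nth false (vals x) j) js = [exists a, b a x].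
  apply/(has_nthP 0%N)/existsP => [[i hi h]|[a h]]; first by exists (Ordinal hi).
  by exists a.
set Z := [set x | _] in gl.
exists (fun x => 1 - g x), (E :|: Z); split.
- by apply: has_degB => //; exact: has_deg_const.
- move=> x; rewrite !inE negb_or => /andP[xE]; rewrite hasE xE /=.
  case: (boolP [exists a, b a x]) => [h|h _]; last by rewrite g1 // subrr.
  by rewrite negbK => /eqP->; rewrite subr0.
- exact: subsetUl.
- by apply: leq_trans (leq_add (leqnn _) gl); rewrite -mulnDl leq_mul2r leq_card_setU orbT.
Qed.

(** Negation costs neither degree nor error, in accordance with [gate_depth]. An AND or OR gate
    multiplies the degree by [2 * l] and adds at most a fraction [1 / 2 ^ l] of the cube to an
    exceptional set shared by all gates. *)
Lemma circuit_approx (inp : cube -> nat -> bool) gs l :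
  (forall i d, (0 < d)%N -> has_deg d (fun x => (inp x i)%:R)) -> (0 < l)%N ->
  exists (P : nat -> cube -> F3) (E : {set cube}),
    [/\ forall j, has_deg ((2 * l) ^ nth 0%N (circ_depths gs) j)%N (P j),
        forall j x, x \notin E -> P j x = (nth false (circ_vals (inp x) gs) j)%:R &
        (#|E| * 2 ^ l <= size gs * 2 ^ N)%N].
Proof.
move=> hin l0; have D0 e : (0 < (2 * l) ^ e)%N by rewrite expn_gt0 muln_gt0 l0.
elim/last_ind: gs => [|gs g [P [E [dP vP cE]]]].
  exists (fun _ _ => 0), set0; split; last by rewrite cards0.
    by move=> j; exact: has_deg_const.
  by move=> j x _; rewrite nth_nil.
suff [p [E' [dp vp sE cE']]] : exists (p : cube -> F3) (E' : {set cube}),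
    [/\ has_deg ((2 * l) ^ gate_depth (circ_depths gs) g)%N p,
        forall x, x \notin E' -> p x = (gate_val (inp x) (circ_vals (inp x) gs) g)%:R,
        E \subset E' & (#|E'| * 2 ^ l <= #|E| * 2 ^ l + 2 ^ N)%N].
  exists (fun j => if j == size gs then p else P j), E'; split.
  - move=> j; rewrite circ_depths_rcons nth_rcons size_circ_depths.
    case: (ltngtP j (size gs)) => [lt|gt|_] //.
    apply: has_deg_leq (dP j); rewrite nth_default ?size_circ_depths //; exact: ltnW.
  - move=> j x xE'; rewrite circ_vals_rcons nth_rcons size_circ_vals.
    have xE : x \notin E by apply: contra xE'; apply: (subsetP sE).
    case: (ltngtP j (size gs)) => [lt|gt|_]; rewrite ?vP ?vp //.
    by rewrite nth_default // size_circ_vals ltnW.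
  - by rewrite size_rcons mulSn addnC; apply: leq_trans cE' _; rewrite leq_add2r.
have same : (#|E| * 2 ^ l <= #|E| * 2 ^ l + 2 ^ N)%N by rewrite leq_addr.
have le_max (js : seq nat) j : j \in js ->
  ((2 * l) ^ nth 0%N (circ_depths gs) j <= (2 * l) ^ (\max_(j <- js) nth 0%N (circ_depths gs) j))%N.
  move=> jj; rewrite leq_pexp2l ?muln_gt0 ?l0 //; exact: (@leq_bigmax_seq _ js xpredT (fun j => nth 0%N (circ_depths gs) j)).
case: g => [i|j|js|js] /=.
- by exists (fun x => (inp x i)%:R), E; split=> //; apply: hin.
- exists (fun x => 1 - P j x), E; split=> //.
    by apply: has_degB; [exact: has_deg_const | exact: dP].
  by move=> x xE; rewrite vP //; case: (nth _ _ _); apply/eqP.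
- have [j jj|//|g [E' [dg vg sE cE']]] := @approx_or (fun x => circ_vals (inp x) gs) P js E
    ((2 * l) ^ (\max_(j <- js) nth 0%N (circ_depths gs) j))%N l true.
    by apply: has_deg_leq (dP j); exact: le_max.
  exists (fun x => 1 - g x), E'; split=> //.
    by apply: has_degB; [exact: has_deg_const | rewrite expnS].
  move=> x xE'; rewrite vg //.
  have -> : has (fun j => true (+) nth false (circ_vals (inp x) gs) j) js
     = ~~ all (fun j => nth false (circ_vals (inp x) gs) j) js by rewrite -has_predC.
  by case: all; apply/eqP.
- have [j jj|//|g [E' [dg vg sE cE']]] := @approx_or (fun x => circ_vals (inp x) gs) P js E
    ((2 * l) ^ (\max_(j <- js) nth 0%N (circ_depths gs) j))%N l false.
    by apply: has_deg_leq (dP j); exact: le_max.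
  by exists g, E'; split=> //; rewrite expnS.
Qed.

Definition parity (x : cube) : bool := odd (\sum_i x i).

Lemma chi_parity x : chi setT x = 1 + (parity x)%:R.
Proof.
rewrite -signF3 /parity signr_odd expr_sum.
by rewrite chiE; apply: eq_bigr => i _; rewrite inE.
Qed.

Lemma parity_circuit_card (inp : cube -> nat -> bool) gs l :
  (forall i d, (0 < d)%N -> has_deg d (fun x => (inp x i)%:R)) -> (0 < l)%N ->
  (forall x, circ_eval gs (inp x) = parity x) ->
  (2 ^ N * 2 ^ l <= #|balls (N./2 + (2 * l) ^ circ_depth gs)| * 2 ^ l + size gs * 2 ^ N)%N.
Proof.
move=> hin l0 hpar; have [P [E [dP vP cE]]] := circuit_approx gs hin l0.
have dle : has_deg ((2 * l) ^ circ_depth gs)%N (P (size gs).-1).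
  apply: has_deg_leq (dP _); rewrite leq_pexp2l ?muln_gt0 ?l0 //.
  have [lt|ge] := ltnP (size gs).-1 (size (circ_depths gs)); last by rewrite nth_default.
  by apply: (@leq_bigmax_seq _ (circ_depths gs) xpredT id) => //; exact: mem_nth.
(* In F_3 one has -1 = 1 + 1, so the full character is 1 plus the parity bit. *)
have hA : {in ~: E, (fun x => 1 + P (size gs).-1 x) =1 chi setT}.
  move=> x; rewrite inE => xE; rewrite chi_parity -hpar vP // /circ_eval.
  by rewrite -(size_circ_vals (inp x)) nth_last.
have := card_agree_parity (has_degD (has_deg_const _ 1) dle) hA.
have : (#|E| + #|~: E| = 2 ^ N)%N by rewrite cardsC card_ffun card_bool card_ord.
move=> e le; rewrite -{1}e mulnDl addnC; apply: leq_add => //; by rewrite leq_mul2r le orbT.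
Qed.

End Smolensky.

(** * Central binomial coefficients and Hamming balls *)

Lemma central_bin M : 'C(M.*2, M) ^ 2 * M.*2.+1 <= 16 ^ M.
Proof.
elim: M => [|M IH] //.
have e1 : 'C(M.*2.+2, M.+1) = 2 * 'C(M.*2.+1, M).
  have := mul_bin_diag M.*2.+2 M; rewrite /= => h.
  apply/eqP; rewrite -(@eqn_pmul2l M.+1) // -h; apply/eqP; lia.
have e2 : M.*2.+1 * 'C(M.*2, M) = M.+1 * 'C(M.*2.+1, M).
  by rewrite (mul_bin_down M.*2.+1 M); congr (_ * _); lia.
rewrite doubleS e1 [16 ^ M.+1]expnS.
set a := 'C(M.*2.+1, M) in e2 *; set b := 'C(M.*2, M) in IH e2 *.
rewrite -(@leq_pmul2l (M.+1 ^ 2)) ?expn_gt0 //.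
have -> : M.+1 ^ 2 * ((2 * a) ^ 2 * M.*2.+3) = 4 * (M.+1 * a) ^ 2 * M.*2.+3 by ring.
rewrite -e2.
have -> : 4 * (M.*2.+1 * b) ^ 2 * M.*2.+3 = (b ^ 2 * M.*2.+1) * (4 * (M.*2.+1 * M.*2.+3)) by ring.
have -> : M.+1 ^ 2 * (16 * 16 ^ M) = 16 ^ M * (16 * M.+1 ^ 2) by ring.
(* What remains is that (2M+1)(2M+3) is at most (2M+2)^2; this is why the weight 2M+1 on the squared
   coefficient survives the induction. *)
apply: leq_mul => //; nia.
Qed.

Lemma bin_right M i : 'C(M.*2, M + i) <= 'C(M.*2, M).
Proof.
elim: i => [|i IH]; first by rewrite addn0.
apply: leq_trans IH; rewrite addnS -(@leq_pmul2l (M + i).+1) // mul_bin_left.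
by apply: leq_mul => //; lia.
Qed.

Lemma card_small M : 2 * #|[set S : {set 'I_M.*2} | #|S| < M]| <= 2 ^ M.*2.
Proof.
rewrite mul2n -addnn -{2}(card_imset _ (@setC_inj 'I_M.*2)).
rewrite -(@card_set_ord M.*2) -cardsUI [X in _ + X](_ : _ = 0) ?addn0 ?max_card //.
apply/eqP; rewrite cards_eq0; apply/eqP/setP => S; rewrite !inE.
apply/negbTE/negP => /andP[h /imsetP[T]]; rewrite inE => hT ST.
by have := cardsC T; rewrite -ST card_ord; lia.
Qed.

(** The sets below the middle layer make up at most half of all sets, by complementation; each of
    the other [d.+1] layers is at most the central one. *)
Lemma card_balls M d : 2 * #|balls M.*2 (M + d)| <= 2 ^ M.*2 + 2 * (d.+1 * 'C(M.*2, M)).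
Proof.
apply: leq_trans (leq_add (card_small M) (leqnn _)); rewrite -mulnDr leq_mul2l /=.
have lay m : #|[set S : {set 'I_M.*2} | #|S| == m]| = 'C(M.*2, m) by rewrite card_draws card_ord.
elim: d => [|d IH].
  rewrite mul1n -(lay M) addn0; apply: leq_trans (leq_card_setU _ _).
  apply: subset_leq_card; apply/subsetP => S; rewrite !inE; by case: ltngtP.
rewrite [d.+2 * _]mulSn [X in _ <= X]addnCA [X in _ <= X]addnC.
apply: leq_trans (leq_add IH (bin_right M d.+1)); rewrite -lay.
apply: leq_trans (leq_card_setU _ _).
by apply: subset_leq_card; apply/subsetP => S; rewrite !inE; lia.
Qed.

(** With this [l] the exceptional set is at most a quarter of the cube, so the ball has at least
    three quarters of its size. The excess over one half must come from the [d.+1] layers, each of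
    relative size at most 1/sqrt(2M+1); squaring avoids the root. *)
Lemma parity_circuit_bound M (inp : {ffun 'I_M.*2 -> bool} -> nat -> bool) gs l :
  (forall i d, 0 < d -> has_deg d (fun x => (inp x i)%:R%R)) -> 0 < l ->
  (forall x, circ_eval gs (inp x) = parity x) -> 4 * size gs <= 2 ^ l ->
  M.*2.+1 <= 16 * ((2 * l) ^ circ_depth gs).+1 ^ 2.
Proof.
move=> hin l0 hpar hs; have := parity_circuit_card hin l0 hpar; rewrite doubleK.
set d := (_ ^ circ_depth gs); have := card_balls M d; have := central_bin M.
have -> : 16 ^ M = 2 ^ M.*2 * 2 ^ M.*2 by rewrite -muln2 mulnC expnM -expnMn.
set B := #|_|; set C := 'C(_, _); set T := 2 ^ M.*2 => hC hB h.
have T0 : 0 < T by rewrite expn_gt0.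
have l2 : 0 < 2 ^ l by rewrite expn_gt0.
have h3 : 3 * T <= 4 * B.
  rewrite -(@leq_pmul2r (2 ^ l)) //.
  have : 4 * size gs * T <= 2 ^ l * T by rewrite leq_mul2r hs orbT.
  by move: h; set L := 2 ^ l; set s := size gs; nia.
have h4 : T <= 4 * d.+1 * C by nia.
have h5 : T * T <= (4 * d.+1 * C) * (4 * d.+1 * C) by exact: leq_mul.
have h6 : T * T * M.*2.+1 <= 16 * d.+1 ^ 2 * (C ^ 2 * M.*2.+1).
  apply: leq_trans (leq_mul h5 (leqnn _)) _; apply: eq_leq; ring.
rewrite -(@leq_pmul2l (T * T)) ?muln_gt0 ?T0 //; apply: leq_trans h6 _.
by rewrite mulnC leq_mul2r hC orbT.
Qed.

Lemma linear_lt_exp2 a b : exists t, a + t * b < 2 ^ t.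
Proof.
exists (2 * (a + 2 * b).+1); rewrite mulnC expnM.
have := ltn_expl (a + 2 * b).+1 (isT : 1 < 2); rewrite -[2 ^ 2]/(2 * 2) expnMn.
set k := 2 ^ _ => h; nia.
Qed.

Lemma poly_lt_exp2 a e : exists m, a * m.+1 ^ e < 2 ^ m.
Proof.
(* Making [m.+1] the power [2 ^ t] bounds the polynomial by a power of two whose exponent is linear
   in [t]. *)
have [t ht] := linear_lt_exp2 a.+1 e; exists (2 ^ t).-1.
rewrite prednK ?expn_gt0 // -expnM.
apply: (@leq_trans (2 ^ (a + t * e))); last by rewrite leq_exp2l //; lia.
by rewrite expnD ltn_pmul2r ?expn_gt0 // ltn_expl.
Qed.

(** * Parity as an instance of prediction *)

Section Reduction.
Variable N : nat.

(** The rightmost digit 0 puts (0,0) next to the cell (-1, 1): the sum bit arriving there has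
    collected all the other digits, and its carry is 0. *)
Definition bits_alpha (x : {ffun 'I_N -> bool}) : seq 'I_3 :=
  ord0 :: [seq inord (x i) | i <- enum 'I_N].

Lemma size_bits_alpha x : size (bits_alpha x) = N.+1.
Proof. by rewrite /= size_map size_enum_ord. Qed.

Lemma digit_bits_alpha x (i : 'I_N) : digit (bits_alpha x) i.+1 = x i.
Proof.
rewrite /digit /= (nth_map i) ?size_enum_ord // nth_ord_enum inordK //.
by case: (x i).
Qed.

(** Both codes of the digit 1 have the same total, so sum bits do not see the context-dependent
    choice made by [enc]. *)
Lemma enc_digit alpha i : exists s c, enc alpha i = Def s c /\ s + c = digit alpha i.
Proof.
rewrite /enc /digit; case: (nth _ _ _) => [[|[|[|m]]] //= lt].
- by exists false, false.
- by case: ifP; [exists true, false | exists false, true].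
- by exists true, true.
Qed.

Lemma qrun_col0 (alpha : seq 'I_3) j : j <= size alpha ->
  qrun (column alpha 0) j = Some (odd (\sum_(i < j) digit alpha (size alpha - i.+1))).
Proof.
elim: j => [|j IH] lt; first by rewrite big_ord0.
rewrite /= IH ?(ltnW lt) // lt /next_q /fin_cell.
have [s [c [-> e]]] := enc_digit alpha (size alpha - j.+1).
by rewrite andbF big_ord_recr /= -e !oddD !oddb addbA.
Qed.

Lemma fin_bits_alpha x : final (bits_alpha x) 1 N = Def (parity x) false.
Proof.
have qE : qrun (column (bits_alpha x) 0) N = Some (parity x).
  rewrite qrun_col0 ?size_bits_alpha // /parity [in RHS](reindex_inj rev_ord_inj) /=.
  congr (Some (odd _)); apply: eq_bigr => i _.
  by rewrite subSS -[in RHS]digit_bits_alpha /= subnSK.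
have c0E : column (bits_alpha x) 0 N = Def false false.
  by rewrite /column size_bits_alpha ltnSn subnn.
by rewrite /final [column _ 1 N]/= -/(column (bits_alpha x) 0 N) c0E qE /new_cell /fin_cell !andbF; case: (parity x).
Qed.

Lemma cinf_bits_alpha x st : cinf (bits_alpha x) (-1)%R 1%R st <-> st = Def (parity x) false.
Proof.
have h := cinf_in (bits_alpha x) 1 N; rewrite fin_bits_alpha size_bits_alpha in h.
have e : (N.+1%:Z - N%:Z = 1)%R by lia.
rewrite e in h; split=> [h'|-> //]; exact: cinf_inj h' h.
Qed.

(** The coordinates are fixed and all digits are 0 or 1, so each circuit input is a constant or one
    bit of [x]. *)
Lemma has_deg_circ_input (R : realType) (K : R) i d : 0 < d ->
  has_deg d (fun x : {ffun 'I_N -> bool} => (circ_input K (bits_alpha x) (-1)%R 1%R i)%:R%R).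
Proof.
move=> d0; have [lt|ge] := ltnP i (2 * N.+1); last first.
  apply: (@has_deg_ext _ _ (fun x => (circ_input K (bits_alpha [ffun=> false]) (-1)%R 1%R i)%:R%R)).
    by move=> x; rewrite /circ_input !size_bits_alpha ltnNge ge.
  exact: has_deg_const.
apply: (@has_deg_ext _ _ (fun x => (bitn (digit (bits_alpha x) i./2) (odd i))%:R%R)).
  by move=> x; rewrite /circ_input size_bits_alpha lt.
case e : (i./2) => [|j].
  apply: (@has_deg_ext _ _ (fun=> 0%R)); last exact: has_deg_const.
  by move=> x; rewrite /bitn /digit /= div0n.
have jN : j < N by lia.
have dE x : digit (bits_alpha x) j.+1 = x (Ordinal jN) by rewrite -digit_bits_alpha.
case: (odd i).
  apply: (@has_deg_ext _ _ (fun=> 0%R)); last exact: has_deg_const.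
  by move=> x; rewrite dE /bitn; case: (x _).
apply: has_deg_ext (has_deg_bit (Ordinal jN) d0) => x.
by rewrite dE /bitn; case: (x _).
Qed.

End Reduction.

Lemma not_in_AC0 (R : realType) (K : R) : (1 <= K)%R -> ~ in_AC0 K.
Proof.
move=> K1 [d [c [Cf [hC hcorr]]]].
(* The factor 8 gives [2 * l <= a * m.+1] below; 64 is 16 times 4, where 4 covers squaring the step
   from D + 1 to 2D. *)
pose a := 8 * c.+1; have a0 : 0 < a by [].
have [m hm] := poly_lt_exp2 (64 * a ^ (2 * d)) (2 * d).
pose M := 2 ^ m; pose gs := Cf M.*2.+1 (Def true false).
(* The string length 2M+1 is at most [2 ^ (m + 2)], whence the first summand; the second pays for
   the additive [c], and the 3 for a factor 8. *)
pose l := c * (m + 2) + c + 3.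
have [hs hd] := hC M.*2.+1 (Def true false).
have l0 : 0 < l by rewrite /l addn3.
have M0 : 0 < M by rewrite expn_gt0.
have hpar (x : {ffun 'I_M.*2 -> bool}) : circ_eval gs (circ_input K (bits_alpha x) (-1)%R 1%R) = parity x :> bool.
  have val : valid_instance K (bits_alpha x) (-1)%R 1%R.
    have h : (1 <= K * (M.*2.+1)%:R)%R.
      by rewrite -[X in (X <= _)%R]mulr1; apply: ler_pM => //; rewrite ler1n.
    by split; rewrite size_bits_alpha.
  have := hcorr _ _ _ (Def true false) val; rewrite size_bits_alpha -/gs => h.
  apply/idP/idP; first by move/h/cinf_bits_alpha => [<-].
  by move=> px; apply/h/cinf_bits_alpha; rewrite px.
have hsz : 4 * size gs <= 2 ^ l.
  have hn : M.*2.+1 ^ c <= 2 ^ (c * (m + 2)).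
    rewrite mulnC expnM; case: (c) => // c'; rewrite leq_exp2r // expnD -/M -[2 ^ 2]/4; lia.
  have hc : c <= 2 ^ c by apply: ltnW; exact: ltn_expl.
  apply: leq_trans (leq_mul (leqnn 4) hs) _; rewrite /l 2!expnD.
  move: hn hc; set u := M.*2.+1 ^ c; set v := 2 ^ (c * (m + 2)); set w := 2 ^ c.
  have : 0 < v by rewrite expn_gt0.
  have : 0 < w by rewrite expn_gt0.
  rewrite -[2 ^ 3]/8 !mulnDr; nia.
have := parity_circuit_bound (@has_deg_circ_input _ R K) l0 hpar hsz.
apply/negP; rewrite -ltnNge.
have hl : 2 * l <= a * m.+1 by rewrite /l /a; nia.
have hdp : (2 * l) ^ circ_depth gs <= (a * m.+1) ^ d.
  apply: leq_trans (leq_pexp2l _ hd) _; first by rewrite muln_gt0.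
  by case: (d) => // d'; rewrite leq_exp2r.
have D0 : 0 < (a * m.+1) ^ d by rewrite expn_gt0 muln_gt0 a0.
have h1 : 16 * ((2 * l) ^ circ_depth gs).+1 ^ 2 <= 64 * (a * m.+1) ^ (2 * d).
  move: hdp D0; rewrite [2 * d]mulnC [(a * m.+1) ^ (d * 2)]expnM.
  set u := _ ^ circ_depth gs; set v := _ ^ d; nia.
apply: leq_ltn_trans h1 _; rewrite expnMn mulnA; apply: ltn_trans hm _.
by rewrite -/M; lia.
Qed.

(** * Sweeping Turing machines *)

Definition sigma_code (s : sigma) : option (bool * option bool) :=
  match s with Undef => None | Half b => Some (b, None) | Def b c => Some (b, Some c) end.
Definition sigma_decode (o : option (bool * option bool)) : sigma :=
  match o with None => Undef | Some (b, None) => Half b | Some (b, Some c) => Def b c end.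
Lemma sigma_codeK : cancel sigma_code sigma_decode. Proof. by case. Qed.
HB.instance Definition _ := Finite.copy sigma (can_type sigma_codeK).

Definition isym_code (s : isym) : option (option (option bool * bool)) :=
  match s with
  | SSep => None | SMinus => Some None
  | SB0 => Some (Some (None, false)) | SB1 => Some (Some (None, true))
  | SD0 => Some (Some (Some false, false)) | SD1 => Some (Some (Some false, true))
  | SD2 => Some (Some (Some true, false))
  end.
Definition isym_decode (o : option (option (option bool * bool))) : isym :=
  match o with
  | None => SSep | Some None => SMinus
  | Some (Some (None, b)) => if b then SB1 else SB0
  | Some (Some (Some false, b)) => if b then SD1 else SD0
  | Some (Some (Some true, _)) => SD2
  end.
Lemma isym_codeK : cancel isym_code isym_decode. Proof. by case. Qed.
HB.instance Definition _ := Finite.copy isym (can_type isym_codeK).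

Section Sweep.
Variables (A S L : finType).
Variables (rstep : S -> A -> S * A) (turn : S -> L * A).
Variables (lstep : L -> A -> L * A) (back : L -> S + sigma).
Variables (start : S) (inp : isym -> A).

(* A sweeping machine alternates left-to-right and right-to-left finite-state
   passes over its nonblank word; it appends one cell at the right end before
   each pass back, and may halt only at the left end. *)
Definition sweep_delta (q : S + L + sigma) (g : option A) : (S + L + sigma) * option A * dir :=
  match q, g with
  | inl (inl s), Some a => let: (s', a') := rstep s a in (inl (inl s'), Some a', MoveR)
  | inl (inl s), None => let: (l, a) := turn s in (inl (inr l), Some a, MoveL)
  | inl (inr l), Some a => let: (l', a') := lstep l a in (inl (inr l'), Some a', MoveL)
  | inl (inr l), None =>
      match back l with
      | inl s => (inl (inl s), None, MoveR)
      | inr st => (inr st, None, Stay)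
      end
  | inr st, _ => (inr st, g, Stay)
  end.

Definition sweepTM : TM :=
  {| tm_Q := (S + L + sigma)%type; tm_G := option A; tm_blank := None;
     tm_in := fun c => Some (inp c); tm_q0 := inl (inl start);
     tm_halt := fun q => if q is inr st then Some st else None;
     tm_delta := sweep_delta |}.

Fixpoint right_run (s : S) (w : seq A) : S * seq A :=
  if w is a :: w' then
    let: (s1, a') := rstep s a in let: (s2, w2) := right_run s1 w' in (s2, a' :: w2)
  else (s, [::]).

Fixpoint left_run (l : L) (w : seq A) : L * seq A :=
  if w is a :: w' then
    let: (l1, w1) := left_run l w' in let: (l2, a') := lstep l1 a in (l2, a' :: w1)
  else (l, [::]).

Definition sweep_round (s : S) (w : seq A) : (S + sigma) * seq A :=
  let: (s1, w1) := right_run s w in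
  let: (l1, a) := turn s1 in
  let: (l2, w2) := left_run l1 w1 in
  (back l2, rcons w2 a).

Fixpoint run_sweeps (r : nat) (s : S) (w : seq A) : option sigma :=
  if r is r'.+1 then
    let: (o, w') := sweep_round s w in
    match o with inl s' => run_sweeps r' s' w' | inr st => Some st end
  else None.

Lemma run_sweeps_inl r s s' w : (sweep_round s w).1 = inl s' ->
  run_sweeps r.+1 s w = run_sweeps r s' (sweep_round s w).2.
Proof. by rewrite /=; case: (sweep_round s w) => o w' /= ->. Qed.

Lemma run_sweeps_inr r s st w : (sweep_round s w).1 = inr st -> run_sweeps r.+1 s w = Some st.
Proof. by rewrite /=; case: (sweep_round s w) => o w' /= ->. Qed.

Definition tape_of (w : seq A) : int -> option A := fun z =>
  if z is Posz k then nth None (map Some w) k else None.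

Lemma size_right_run s w : size (right_run s w).2 = size w.
Proof.
elim: w s => //= a w IH s; case: (rstep s a) => s1 a'.
by have := IH s1; case: (right_run s1 w) => s2 w2 /= ->.
Qed.

Lemma size_left_run l w : size (left_run l w).2 = size w.
Proof.
elim: w => //= a w IH; move: IH; case: (left_run l w) => l1 w1 /= <-.
by case: (lstep l1 a).
Qed.

Lemma size_sweep_round s w : size (sweep_round s w).2 = (size w).+1.
Proof.
rewrite /sweep_round; have := size_right_run s w; case: (right_run s w) => s1 w1 /= <-.
case: (turn s1) => l1 a; have := size_left_run l1 w1; case: (left_run l1 w1) => l2 w2 /= <-.
by rewrite size_rcons.
Qed.

Lemma left_run_rcons l w a :
  left_run l (rcons w a) =
    let: (l1, a') := lstep l a in let: (l2, w') := left_run l1 w in (l2, rcons w' a').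
Proof.
elim: w => [|b w IH] /=; first by case: (lstep l a).
rewrite IH; case: (lstep l a) => l1 a'; case: (left_run l1 w) => l2 w' /=.
by case: (lstep l2 b).
Qed.

Lemma tape_cat w1 a w2 : tape_of (w1 ++ a :: w2) (Posz (size w1)) = Some a.
Proof. by rewrite /tape_of map_cat nth_cat size_map ltnn subnn. Qed.

Lemma tape_write w1 a a' w2 :
  (fun z => if z == Posz (size w1) then Some a' else tape_of (w1 ++ a :: w2) z) =
  tape_of (w1 ++ a' :: w2).
Proof.
apply: functional_extensionality => -[k|k] //=.
rewrite !map_cat !nth_cat size_map eqz_nat; case: ltngtP => //= [lt|->]; last by rewrite subnn.
by rewrite -subn_gt0 in lt; case: (k - size w1) lt.
Qed.

Lemma tape_blank w : tape_of w (Posz (size w)) = None.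
Proof. by rewrite /= nth_default // size_map. Qed.

Lemma tape_append w a :
  (fun z => if z == Posz (size w) then Some a else tape_of w z) = tape_of (rcons w a).
Proof.
apply: functional_extensionality => -[k|k] //=.
rewrite map_rcons nth_rcons size_map eqz_nat; case: ltngtP => // lt.
by rewrite nth_default // size_map ltnW.
Qed.

Lemma tape_left w :
  (fun z => if z == (-1)%R then None else tape_of w z) = tape_of w.
Proof. by apply: functional_extensionality => -[k|[|k]]. Qed.

Notation step := (@tm_step sweepTM).

Lemma step_inl (q : S + L) (tape : int -> option A) (pos : int) :
  step (inl q, tape, pos) =
  let: (q', g, d) := sweep_delta (inl q) (tape pos) in
  (q', (fun z => if z == pos then g else tape z), (pos + dir_int d)%R).
Proof. by []. Qed.

Lemma right_pass s w1 w2 :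
  iter (size w2) step (inl (inl s), tape_of (w1 ++ w2), Posz (size w1)) =
  (inl (inl (right_run s w2).1), tape_of (w1 ++ (right_run s w2).2), Posz (size w1 + size w2)).
Proof.
elim: w2 s w1 => [|a w2 IH] s w1; first by rewrite /= addn0.
rewrite [size (a :: w2)]/= iterSr step_inl tape_cat.
rewrite [sweep_delta _ _]/= [right_run s (a :: w2)]/=.
case: (rstep s a) => s1 a'; rewrite tape_write.
have -> : (Posz (size w1) + dir_int MoveR)%R = Posz (size (rcons w1 a')).
  by rewrite size_rcons /dir_int; lia.
rewrite -cat_rcons IH; case: (right_run s1 w2) => s2 w' /=.
by rewrite cat_rcons size_rcons addSnnS.
Qed.

Lemma left_pass l w1 w2 :
  iter (size w1) step (inl (inr l), tape_of (w1 ++ w2), Posz (size w1) - 1)%R =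
  (inl (inr (left_run l w1).1), tape_of ((left_run l w1).2 ++ w2), (-1)%R).
Proof.
elim/last_ind: w1 l w2 => [|w1 a IH] l w2 //.
rewrite size_rcons iterSr step_inl cat_rcons.
have -> : (Posz (size w1).+1 - 1)%R = Posz (size w1) by lia.
rewrite tape_cat [sweep_delta _ _]/= left_run_rcons.
case: (lstep l a) => l1 a'; rewrite tape_write [dir_int _]/= IH.
by case: (left_run l1 w1) => l2 w' /=; rewrite cat_rcons.
Qed.

(** Two passes over the word, plus one step at the blank on each end. *)
Lemma sweep_round_steps s w :
  iter (size w).+1.*2 step (inl (inl s), tape_of w, 0%R) =
  match (sweep_round s w).1 with
  | inl s' => (inl (inl s'), tape_of (sweep_round s w).2, 0%R)
  | inr st => (inr st, tape_of (sweep_round s w).2, (-1)%R)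
  end.
Proof.
have -> : (size w).+1.*2 = 1 + (size w + (1 + size w)) by lia.
rewrite iterD [iter (size w + _) _ _]iterD [iter (1 + size w) _ _]iterD.
rewrite (right_pass s [::] w) add0n /sweep_round.
have := size_right_run s w; case: (right_run s w) => s1 w1.
rewrite -[(s1, w1).1]/s1 -[(s1, w1).2]/w1 => sw.
have one cf : iter 1 step cf = step cf by [].
rewrite -sw !one -[[::] ++ w1]/w1 (step_inl (inl s1)) tape_blank [sweep_delta _ _]/=.
case: (turn s1) => l1 a; rewrite tape_append [dir_int _]/= -cats1.
have := size_left_run l1 w1; have := left_pass l1 w1 [:: a].
case: (left_run l1 w1) => l2 w2 /= -> _.
rewrite step_inl [sweep_delta _ _]/= cats1.
by case: (back l2) => st; rewrite tape_left.
Qed.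

(** Each round lengthens the word by one cell, so no round starts on more than [size w + r]
    cells. *)
Lemma run_sweeps_steps r s w st : run_sweeps r s w = Some st ->
  exists2 t, (t <= r * (size w + r).+1.*2)%N &
    (iter t step (inl (inl s), tape_of w, 0%R)).1.1 = inr st.
Proof.
elim: r s w => [|r IH] s w //=.
have := size_sweep_round s w; have := sweep_round_steps s w; move eT : (size w).+1.*2 => T.
case: (sweep_round s w) => -[s'|st'] w' /= E sw; last first.
  move=> [<-]; exists T; last by rewrite E.
  by rewrite -eT mulSn; apply: leq_trans (leq_addr _ _); rewrite leq_double; lia.
move=> /IH[t lt tE]; exists (t + T); last by rewrite iterD E.
rewrite -eT mulSn addnC leq_add ?leq_double //; first by lia.
by apply: leq_trans lt _; rewrite sw leq_mul // leq_double; lia.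
Qed.

Lemma tm_init_sweep w : tm_init sweepTM w = (inl (inl start), tape_of (map inp w), 0%R).
Proof.
rewrite /tm_init /=; congr (_, _, _); apply: functional_extensionality => -[k|k] //=.
have [lt|ge] := ltnP k (size w); last by rewrite drop_oversize // nth_default // !size_map.
by rewrite (drop_nth SD0) // (nth_map (inp SD0)) ?size_map // (nth_map SD0).
Qed.

Lemma sweepTM_output r w st : run_sweeps r start (map inp w) = Some st ->
  exists2 t, (t <= r * (size w + r).+1.*2)%N & tm_output sweepTM w t = Some st.
Proof.
move=> /run_sweeps_steps[t]; rewrite size_map => lt E; exists t => //.
by rewrite /tm_output tm_init_sweep E.
Qed.

End Sweep.

(** * The prediction machine *)

(* A tape cell carries an input symbol ([None] on appended cells), a cell state
   of the current CQCA column, and a mark.  The first mark is the row to be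
   read off: it starts on the first separator, i.e. on row y = 0, and is shifted
   |y| times.  The second separator is marked too, which is harmless. *)
Definition cell : Type := (option isym * sigma * bool)%type.

Variant rcmd := RNop | RShift | RColumn.
Definition rcmd_code (c : rcmd) : option bool :=
  match c with RNop => None | RShift => Some false | RColumn => Some true end.
Definition rcmd_decode (o : option bool) : rcmd :=
  match o with None => RNop | Some false => RShift | Some true => RColumn end.
Lemma rcmd_codeK : cancel rcmd_code rcmd_decode. Proof. by case. Qed.
HB.instance Definition _ := Finite.copy rcmd (can_type rcmd_codeK).

Variant lcmd := LHalt of sigma | LDecX | LEnc | LDecY of bool.
Definition lcmd_code (c : lcmd) : sigma + option (option bool) :=
  match c with
  | LHalt st => inl st | LDecX => inr None | LEnc => inr (Some None) | LDecY b => inr (Some (Some b))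
  end.
Definition lcmd_decode (o : sigma + option (option bool)) : lcmd :=
  match o with
  | inl st => LHalt st | inr None => LDecX | inr (Some None) => LEnc | inr (Some (Some b)) => LDecY b
  end.
Lemma lcmd_codeK : cancel lcmd_code lcmd_decode. Proof. by case. Qed.
HB.instance Definition _ := Finite.copy lcmd (can_type lcmd_codeK).

(* (sign of x, x <> 0, sign of y, y <> 0) at the end of a pass; in the middle of
   a pass, the data of the previous and of the current section of the word. *)
Definition flags : Type := (bool * bool * bool * bool)%type.

Definition flag_step (fl : flags) (c : option isym) : flags :=
  let: (ps, pn, cs, cn) := fl in
  match c with
  | Some SMinus => (ps, pn, true, cn)
  | Some SB1 => (ps, pn, cs, true)
  | Some SSep => (cs, cn, false, false)
  | _ => fl
  end.

Definition rstate : Type := (rcmd * flags * option bool * option sigma * bool)%type.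

Definition ans_step (ans : option sigma) (q : option bool) (a : sigma) (mk : bool) : option sigma :=
  if ans is Some _ then ans else if mk then Some (fin_cell q a) else None.

Definition col_out (cmd : rcmd) (q : option bool) (a : sigma) : sigma :=
  if cmd is RColumn then new_cell q a else a.

(** A finite-state pass moves information only in its own direction: marks move down ([y < 0]) on
    right passes and up ([y > 0]) on left passes. *)
Definition shift_out (cmd : rcmd) (m mk : bool) : bool := if cmd is RShift then m else mk.

Definition rstep (s : rstate) (x : cell) : rstate * cell :=
  let: (cmd, fl, q, ans, m) := s in
  let: (c, a, mk) := x in
  ((cmd, flag_step fl c, next_q q a, ans_step ans q a mk, mk),
   (c, col_out cmd q a, shift_out cmd m mk)).

Definition rstart (cmd : rcmd) : rstate := (cmd, (false, false, false, false), Some false, None, false).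

Definition lstate : Type := (lcmd * bool * bool * bool)%type.

(* [LHalt Undef] is the case x > 0. *)
Definition turn_cmd (cmd : rcmd) (fl : flags) (ans : option sigma) : lcmd :=
  let: (sx, nx, sy, ny) := fl in
  if cmd is RColumn then (if nx then LDecX else LHalt (odflt Undef ans))
  else if ~~ sx && nx then LHalt Undef
  else if ~~ ny then LEnc
  else LDecY (~~ sy).

Definition dec_y (d : lcmd) : bool := if d is LDecY _ then true else false.

(** The appended cell catches a mark pushed off the right end, so the row to be read always lies on
    the tape. *)
Definition turn (s : rstate) : lstate * cell :=
  let: (cmd, fl, q, ans, m) := s in
  let: d := turn_cmd cmd fl ans in
  ((d, dec_y d, false, false), (None, Undef, if cmd is RShift then m else false)).

(* Binary decrement, read from the least significant digit with borrow [b].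
   Since the decremented number is nonzero, the borrow dies inside its section;
   for x it is raised at the separator to the right of x. *)
Definition ctl_step (d : lcmd) (b : bool) (c : option isym) : bool * option isym :=
  match c with
  | Some SB0 => (b, Some (if b then SB1 else SB0))
  | Some SB1 => (false, Some (if b then SB0 else SB1))
  | Some SSep => (if d is LDecX then true else false, c)
  | _ => (b, c)
  end.

(** The digits stay on the control track, so column 0 may be rewritten at will until the column
    passes start; under [LDecX] the cells hold later columns and must be kept. *)
Definition enc_out (d : lcmd) (e : bool) (c : option isym) (a : sigma) : sigma :=
  match d, c with
  | LDecX, _ => a
  | _, Some SD0 => Def false false
  | _, Some SD1 => if e then Def true false else Def false true
  | _, Some SD2 => Def true true
  | _, _ => a
  end.

(** The code of a digit 1 depends on the nearest other digit to its right; a leftward pass needs one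
    bit to remember whether that digit is 2. *)
Definition enc_state (e : bool) (c : option isym) : bool :=
  match c with Some SD0 => false | Some SD2 => true | _ => e end.

Definition lstep (s : lstate) (x : cell) : lstate * cell :=
  let: (d, b, e, m) := s in
  let: (c, a, mk) := x in
  let: (b', c') := ctl_step d b c in
  ((d, b', enc_state e c, mk), (c', enc_out d e c a, if d is LDecY true then m else mk)).

(* A mark leaving the word at its left end means y > n. *)
Definition back (s : lstate) : rstate + sigma :=
  let: (d, b, e, m) := s in
  match d with
  | LHalt st => inr st
  | LDecX | LEnc => inl (rstart RColumn)
  | LDecY true => if m then inr Undef else inl (rstart RNop)
  | LDecY false => inl (rstart RShift)
  end.

Definition init_cell (c : isym) : cell := (Some c, Undef, if c is SSep then true else false).

Definition cqcaTM : TM := sweepTM rstep turn lstep back (rstart RNop) init_cell.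

(** * One round, track by track *)

Definition ctl (w : seq cell) : seq (option isym) := [seq x.1.1 | x <- w].
Definition cells (w : seq cell) : seq sigma := [seq x.1.2 | x <- w].
Definition marks (w : seq cell) : seq bool := [seq x.2 | x <- w].

Fixpoint col_pass (q : option bool) (cs : seq sigma) : seq sigma :=
  if cs is a :: cs' then new_cell q a :: col_pass (next_q q a) cs' else [::].

Fixpoint ans_pass (ans : option sigma) (q : option bool) (cs : seq sigma) (ms : seq bool) : option sigma :=
  match cs, ms with
  | a :: cs', m :: ms' => ans_pass (ans_step ans q a m) (next_q q a) cs' ms'
  | _, _ => ans
  end.

Fixpoint ctl_pass (d : lcmd) (b : bool) (cs : seq (option isym)) : bool * seq (option isym) :=
  if cs is c :: cs' then
    let: (b1, cs1) := ctl_pass d b cs' in let: (b2, c') := ctl_step d b1 c in (b2, c' :: cs1)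
  else (b, [::]).

Fixpoint enc_pass (d : lcmd) (e : bool) (cs : seq (option isym)) (a : seq sigma) : seq sigma :=
  match cs, a with
  | c :: cs', x :: a' => enc_out d (foldr (fun c e => enc_state e c) e cs') c x :: enc_pass d e cs' a'
  | _, _ => [::]
  end.

Notation rrun := (right_run rstep).
Notation lrun := (left_run lstep).
Notation round := (sweep_round rstep turn lstep back).
Notation run_rounds := (run_sweeps rstep turn lstep back).

Lemma rrun_spec cmd fl q ans m w :
  let: (s, w') := rrun (cmd, fl, q, ans, m) w in
  [/\ s = (cmd, foldl flag_step fl (ctl w), foldl next_q q (cells w), ans_pass ans q (cells w) (marks w), last m (marks w)),
      ctl w' = ctl w, cells w' = (if cmd is RColumn then col_pass q (cells w) else cells w) &
      marks w' = (if cmd is RShift then belast m (marks w) else marks w)].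
Proof.
elim: w fl q ans m => [|[[c a] mk] w IH] fl q ans m; first by split=> //; case: cmd.
rewrite /=; have := IH (flag_step fl c) (next_q q a) (ans_step ans q a mk) mk.
by case: (rrun _ w) => s w' [-> e1 e2 e3]; rewrite /= e1 e2 e3; split=> //; case: (cmd).
Qed.

Lemma lrun_spec d b e m w :
  let: (s, w') := lrun (d, b, e, m) w in
  [/\ s = (d, (ctl_pass d b (ctl w)).1, foldr (fun c e => enc_state e c) e (ctl w), head m (marks w)),
      ctl w' = (ctl_pass d b (ctl w)).2, cells w' = enc_pass d e (ctl w) (cells w) &
      marks w' = (if d is LDecY true then behead (rcons (marks w) m) else marks w)].
Proof.
elim: w => [|[[c a] mk] w IH]; first by split=> //; case: d => // -[].
rewrite /=; move: IH; case: (lrun _ w) => s w' [-> e1 e2 e3] /=.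
case: (ctl_pass d b (ctl w)) e1 => b1 cs1 /= e1; case: (ctl_step d b1 c) => b2 c' /=.
rewrite e1 e2 e3; split=> //; case: (d) => // -[] //.
by case: (marks w).
Qed.

Definition is_shift (cmd : rcmd) : bool := if cmd is RShift then true else false.

Lemma round_spec cmd w :
  let fl := foldl flag_step (false, false, false, false) (ctl w) in
  let ans := ans_pass None (Some false) (cells w) (marks w) in
  let d := turn_cmd cmd fl ans in
  let ms := if is_shift cmd then belast false (marks w) else marks w in
  let w' := (round (rstart cmd) w).2 in
  [/\ exists b e, (round (rstart cmd) w).1 = back (d, b, e, head false ms),
      ctl w' = rcons (ctl_pass d (dec_y d) (ctl w)).2 None,
      cells w' = rcons (enc_pass d false (ctl w)
                   (if cmd is RColumn then col_pass (Some false) (cells w) else cells w)) Undef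
    & marks w' = rcons (if d is LDecY true then behead (rcons ms false) else ms)
                   (is_shift cmd && last false (marks w))].
Proof.
rewrite /sweep_round /rstart.
have := rrun_spec cmd (false, false, false, false) (Some false) None false w.
case: (rrun _ w) => s w1 [-> e1 e2 e3] /=.
set d := turn_cmd _ _ _.
have := lrun_spec d (dec_y d) false false w1.
case: (lrun _ w1) => l w2 [-> f1 f2 f3].
rewrite [_.1]/= [(_, _).2]/= /ctl /cells /marks !map_rcons.
rewrite -[map _ w2]/(ctl w2) -[X in [/\ _, _, rcons X _ = _ & _]]/(cells w2) -[X in [/\ _, _, _ & rcons X _ = _]]/(marks w2).
rewrite f1 f2 f3 e1 e2 e3.
split=> //; first by exists true, true; rewrite -[[seq x.2 | x <- w1]]/(marks w1) e3; case: (cmd).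
by rewrite /is_shift; case: (cmd).
Qed.

(** * The control track: counters, signs and flags *)

Definition bits (bs : seq bool) : seq (option isym) := [seq Some (if b then SB1 else SB0) | b <- bs].
Definition bits_val (bs : seq bool) : nat := foldl (fun v (b : bool) => v.*2 + b) 0 bs.
Definition sgn (s : bool) : seq (option isym) := if s then [:: Some SMinus] else [::].
Definition digs (ds : seq 'I_3) : seq (option isym) := [seq Some (digit_sym d) | d <- rev ds].

(** The counters are arbitrary bit lists since a decrement keeps the length and may create leading
    zeros. The trailing [None] symbols belong to cells appended by earlier rounds. *)
Definition control (ds : seq 'I_3) (sx : bool) xb (sy : bool) yb r : seq (option isym) :=
  digs ds ++ Some SSep :: sgn sx ++ bits xb ++ Some SSep :: sgn sy ++ bits yb ++ nseq r None.

Lemma bits_val_rcons bs b : bits_val (rcons bs b) = (bits_val bs).*2 + b.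
Proof. by rewrite /bits_val foldl_rcons. Qed.

Lemma bits_rcons bs b : bits (rcons bs b) = rcons (bits bs) (Some (if b then SB1 else SB0)).
Proof. by rewrite /bits map_rcons. Qed.

Lemma ctl_pass_cat d b u v :
  ctl_pass d b (u ++ v) =
  ((ctl_pass d (ctl_pass d b v).1 u).1, (ctl_pass d (ctl_pass d b v).1 u).2 ++ (ctl_pass d b v).2).
Proof.
elim: u => [|c u IH] /=; first by case: (ctl_pass d b v).
rewrite IH; case: (ctl_pass d b v) => b1 v' /=; case: (ctl_pass d b1 u) => b2 u' /=.
by case: (ctl_step d b2 c).
Qed.

Lemma ctl_pass_bits0 d bs : ctl_pass d false (bits bs) = (false, bits bs).
Proof. by elim: bs => //= b bs ->; case: b. Qed.

(** A last bit 1 absorbs the borrow; a last bit 0 becomes 1 and passes it on to the remaining bits,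
    whose value is then still positive. *)
Lemma ctl_pass_bits1 d bs : 0 < bits_val bs ->
  exists2 bs', ctl_pass d true (bits bs) = (false, bits bs') & bits_val bs' = (bits_val bs).-1.
Proof.
elim/last_ind: bs => [|bs b IH] //; rewrite bits_val_rcons bits_rcons -cats1 ctl_pass_cat.
case: b => [_|] /=.
  by exists (rcons bs false); rewrite ?ctl_pass_bits0 ?bits_val_rcons ?bits_rcons ?cats1 //; lia.
rewrite addn0 double_gt0 => /[dup] h /IH[bs' -> e].
exists (rcons bs' true); rewrite ?bits_val_rcons ?bits_rcons ?cats1 //; lia.
Qed.

Lemma ctl_pass_sgn d b s : ctl_pass d b (sgn s) = (b, sgn s).
Proof. by case: s. Qed.

Lemma ctl_pass_digs d b ds : ctl_pass d b (digs ds) = (b, digs ds).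
Proof. by rewrite /digs; elim: (rev ds) => //= -[[|[|[|m]]] lt] s -> //. Qed.

Lemma ctl_pass_pad d b r : ctl_pass d b (nseq r None) = (b, nseq r None).
Proof. by elim: r => //= r ->. Qed.

Lemma ctl_pass_sep d b v :
  ctl_pass d b (Some SSep :: v) =
  ((if d is LDecX then true else false), Some SSep :: (ctl_pass d b v).2).
Proof. by rewrite /=; case: (ctl_pass d b v). Qed.

Definition ctl_passE := (ctl_pass_cat, ctl_pass_sep, ctl_pass_digs, ctl_pass_sgn, ctl_pass_pad, ctl_pass_bits0).

Lemma ctl_pass_enc ds sx xb sy yb r :
  (ctl_pass LEnc false (control ds sx xb sy yb r)).2 = control ds sx xb sy yb r.
Proof. by rewrite /control !ctl_passE /=. Qed.

Lemma ctl_pass_decX ds sx xb sy yb r : 0 < bits_val xb ->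
  exists2 xb', (ctl_pass LDecX false (control ds sx xb sy yb r)).2 = control ds sx xb' sy yb r &
    bits_val xb' = (bits_val xb).-1.
Proof.
move=> /(ctl_pass_bits1 LDecX)[xb' E h]; exists xb' => //.
by rewrite /control !(ctl_passE, E) /=.
Qed.

Lemma ctl_pass_decY ds sx xb sy yb r pos : 0 < bits_val yb ->
  exists2 yb', (ctl_pass (LDecY pos) true (control ds sx xb sy yb r)).2 = control ds sx xb sy yb' r &
    bits_val yb' = (bits_val yb).-1.
Proof.
move=> /(ctl_pass_bits1 (LDecY pos))[yb' E h]; exists yb' => //.
by rewrite /control !(ctl_passE, E) /=.
Qed.

Lemma control_pad ds sx xb sy yb r :
  rcons (control ds sx xb sy yb r) None = control ds sx xb sy yb r.+1.
Proof. by rewrite /control !(rcons_cat, rcons_cons) -cats1 -[[:: None]]/(nseq 1 None) -nseqD addn1. Qed.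

Lemma foldl_flag_digs fl ds : foldl flag_step fl (digs ds) = fl.
Proof.
rewrite /digs; elim: (rev ds) fl => //= d s IH [[[ps pn] cs] cn].
by case: d => [[|[|[|m]]] lt] //=; rewrite IH.
Qed.

Lemma bits_val_gt0 bs : (0 < bits_val bs) = has id bs.
Proof.
elim/last_ind: bs => // bs b IH; rewrite bits_val_rcons has_rcons -IH; case: b => /=; lia.
Qed.

Lemma foldl_flag_bits ps pn cs cn bs :
  foldl flag_step (ps, pn, cs, cn) (bits bs) = (ps, pn, cs, cn || (0 < bits_val bs)).
Proof.
rewrite bits_val_gt0; elim: bs cn => [|b bs IH] cn /=; first by rewrite orbF.
by case: b => /=; rewrite IH ?orbT.
Qed.

Lemma foldl_flag_control ds sx xb sy yb r :
  foldl flag_step (false, false, false, false) (control ds sx xb sy yb r) =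
  (sx, 0 < bits_val xb, sy, 0 < bits_val yb).
Proof.
rewrite /control foldl_cat foldl_flag_digs /= foldl_cat.
have -> : foldl flag_step (false, false, false, false) (sgn sx) = (false, false, sx, false) by case: sx.
rewrite foldl_cat foldl_flag_bits /= foldl_cat.
have -> : foldl flag_step (sx, 0 < bits_val xb, false, false) (sgn sy) = (sx, 0 < bits_val xb, sy, false) by case: sy.
by rewrite foldl_cat foldl_flag_bits /=; elim: r.
Qed.

(** * The encoding pass and the column pass *)

Lemma size_digs ds : size (digs ds) = size ds.
Proof. by rewrite size_map size_rev. Qed.

Lemma size_enc_pass d e cs a : size cs = size a -> size (enc_pass d e cs a) = size a.
Proof. by elim: cs a => [|c cs IH] [|x a] //= [h]; rewrite IH. Qed.

Lemma nth_enc_pass d e cs a j : size cs = size a -> j < size a ->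
  nth Undef (enc_pass d e cs a) j =
  enc_out d (foldr (fun c e => enc_state e c) e (drop j.+1 cs)) (nth None cs j) (nth Undef a j).
Proof. by elim: cs a j => [|c cs IH] [|x a] // [|j] //= [h] lt; [rewrite drop0 | rewrite IH]. Qed.

Lemma enc_state_prev ds i : i <= size ds ->
  foldr (fun c e => enc_state e c) false (digs (take i ds)) = (prev_non1 ds i == Some 2).
Proof.
elim: i => [|i IH] lt; first by rewrite take0.
rewrite (take_nth ord0) // /digs rev_rcons /= -/(digs _) IH ?(ltnW lt) //.
rewrite /digit; case: (nth ord0 ds i) => [[|[|[|m]]] h] //=.
Qed.

(** Binary digits are symbols distinct from the ternary ones, so the encoder reaches the last
    ternary digit still in state false, which stands for the case [None] of [prev_non1]. *)
Lemma enc_state_tail sx xb sy yb r :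
  foldr (fun c e => enc_state e c) false
    (Some SSep :: sgn sx ++ bits xb ++ Some SSep :: sgn sy ++ bits yb ++ nseq r None) = false.
Proof.
have fb e bs : foldr (fun c e => enc_state e c) e (bits bs) = e by elim: bs => //= -[].
have fs e s : foldr (fun c e => enc_state e c) e (sgn s) = e by case: s.
have fp e m : foldr (fun c e => enc_state e c) e (nseq m None) = e by elim: m.
by rewrite /= !foldr_cat /= !foldr_cat fp fb fs fb fs.
Qed.

Lemma nth_tail sx xb sy yb r j :
  nth None (Some SSep :: sgn sx ++ bits xb ++ Some SSep :: sgn sy ++ bits yb ++ nseq r None) j
  \notin [:: Some SD0; Some SD1; Some SD2].
Proof.
set s := _ :: _; have [lt|ge] := ltnP j (size s); last by rewrite nth_default.
pose nodig (c : option isym) := c \notin [:: Some SD0; Some SD1; Some SD2].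
have fb bs : all nodig (bits bs) by elim: bs => //= -[].
have fs b : all nodig (sgn b) by case: b.
have fp m : all nodig (nseq m None) by elim: m.
have : all nodig s by rewrite /= !all_cat /= !all_cat fp !fb !fs.
by move/(all_nthP None)/(_ j lt).
Qed.

Lemma nth_enc_control ds sx xb sy yb r d a j :
  size (control ds sx xb sy yb r) = size a -> d <> LDecX ->
  (forall j, size ds <= j -> nth Undef a j = Undef) ->
  nth Undef (enc_pass d false (control ds sx xb sy yb r) a) j = column ds 0 j.
Proof.
move=> sz dX aU; have [lt|ge] := ltnP j (size a); last first.
  rewrite nth_default ?size_enc_pass // /column ltnNge.
  suff -> : size ds <= j by [].
  by apply: leq_trans ge; rewrite -sz /control size_cat size_digs leq_addr.
rewrite nth_enc_pass // /column; have [jn|nj] := ltnP j (size ds).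
  rewrite /control drop_cat nth_cat size_digs jn.
  have -> : foldr (fun c e => enc_state e c) false
     (if j.+1 < size ds then drop j.+1 (digs ds) ++ Some SSep :: sgn sx ++ bits xb ++ Some SSep :: sgn sy ++ bits yb ++ nseq r None
      else drop (j.+1 - size ds) (Some SSep :: sgn sx ++ bits xb ++ Some SSep :: sgn sy ++ bits yb ++ nseq r None))
     = (prev_non1 ds (size ds - j.+1) == Some 2).
    rewrite -enc_state_prev ?leq_subr // /digs.
    case: ltnP => h.
      by rewrite foldr_cat enc_state_tail -map_drop drop_rev.
    have -> : j.+1 - size ds = 0 by lia.
    have -> : size ds - j.+1 = 0 by lia.
    by rewrite drop0 enc_state_tail take0.
  rewrite /digs (nth_map ord0) ?size_rev // nth_rev // /enc /digit.
  by case: d dX {sz aU} => //; case: (nth ord0 ds _) => [[|[|[|m]]] h].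
rewrite /control nth_cat size_digs ltnNge nj /= aU //.
have := nth_tail sx xb sy yb r (j - size ds).
case: (nth _ _ _) => [[]|] //; by case: (d).
Qed.


Lemma foldl_next_q cs p : p <= size cs ->
  foldl next_q (Some false) (take p cs) = qrun (nth Undef cs) p.
Proof.
elim: p => [|p IH] lt; first by rewrite take0.
by rewrite (take_nth Undef) // foldl_rcons IH // ltnW.
Qed.

Lemma eq_qrun a b p : (forall j, j < p -> a j = b j) -> qrun a p = qrun b p.
Proof. by elim: p => //= p IH H; rewrite IH ?H // => j lt; apply: H; exact: ltnW. Qed.

Lemma nth_col_pass q cs j : j < size cs ->
  nth Undef (col_pass q cs) j = new_cell (foldl next_q q (take j cs)) (nth Undef cs j).
Proof. by elim: cs q j => [|a cs IH] q [|j] //= lt; rewrite IH. Qed.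

Lemma size_col_pass q cs : size (col_pass q cs) = size cs.
Proof. by elim: cs q => //= a cs IH q; rewrite IH. Qed.

Lemma ans_pass_some v q cs ms : ans_pass (Some v) q cs ms = Some v.
Proof. by elim: cs q ms => [|a cs IH] q [|m ms] //=. Qed.

Lemma ans_pass_first q cs p rest : p < size cs ->
  ans_pass None q cs (nseq p false ++ true :: rest) =
  Some (fin_cell (foldl next_q q (take p cs)) (nth Undef cs p)).
Proof.
elim: cs q p => [|a cs IH] q [|p] //= lt; first by rewrite ans_pass_some.
by rewrite IH.
Qed.

Lemma enc_pass_decX e cs a : size cs = size a -> enc_pass LDecX e cs a = a.
Proof. by elim: cs a => [|c cs IH] [|x a] //= [h]; rewrite IH. Qed.

(* [k] columns are done, [u] remain, and the row to be read off is [p]. *)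
Definition inv_x ds k u p w := exists sx xb sy yb r rest,
  [/\ ctl w = control ds sx xb sy yb r, bits_val xb = u,
      marks w = nseq p false ++ true :: rest &
      forall j, j <= p -> nth Undef (cells w) j = column ds k j].

Lemma size_cells w : size (cells w) = size w. Proof. exact: size_map. Qed.
Lemma size_ctl w : size (ctl w) = size w. Proof. exact: size_map. Qed.
Lemma size_marks w : size (marks w) = size w. Proof. exact: size_map. Qed.

Lemma x_round ds k u p w : inv_x ds k u p w ->
  if u is u'.+1 then
    (round (rstart RColumn) w).1 = inl (rstart RColumn) /\
    inv_x ds k.+1 u' p (round (rstart RColumn) w).2
  else (round (rstart RColumn) w).1 = inr (final ds k p).
Proof.
move=> [sx [xb [sy [yb [r [rest [cE uE mE aE]]]]]]].
have pw : p < size w by rewrite -size_marks mE size_cat size_nseq /= -addSnnS leq_addr.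
have qE j : j <= p -> foldl next_q (Some false) (take j (cells w)) = qrun (column ds k) j.
  move=> le; rewrite foldl_next_q ?size_cells; last by lia.
  by apply: eq_qrun => i lt; apply: aE; lia.
have := round_spec RColumn w; rewrite /= cE foldl_flag_control mE ans_pass_first ?size_cells //.
rewrite qE // aE // -/(final ds k p) /= uE.
case: u uE => [|u] uE /=; first by case=> -[b [e ->]].
case=> -[b [e ->]] c2 a2 m2; split=> //.
have xpos : 0 < bits_val xb by rewrite uE.
have [xb' cE' uE'] := ctl_pass_decX ds sx sy yb r xpos.
exists sx, xb', sy, yb, r.+1, (rcons rest false); split.
- by rewrite c2 cE' control_pad.
- by rewrite uE' uE.
- by rewrite m2 rcons_cat rcons_cons.
(* Row [p] lies within the old word because its mark does; nothing is claimed about the appended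
   cell, which enters as [Undef]. *)
- move=> j le; rewrite a2 enc_pass_decX ?size_col_pass ?size_cells -?cE ?size_ctl // nth_rcons.
  rewrite size_col_pass size_cells (leq_ltn_trans le pw) nth_col_pass ?size_cells; last by lia.
  by rewrite qE // aE.
Qed.

Lemma x_phase ds k u p w : inv_x ds k u p w ->
  run_rounds u.+1 (rstart RColumn) w = Some (final ds (k + u) p).
Proof.
elim: u k w => [|u IH] k w /x_round.
  by move=> /run_sweeps_inr ->; rewrite addn0.
by case=> /run_sweeps_inl -> /IH ->; rewrite addSnnS.
Qed.

(* [v] shifts remain.  A right shift ordered by [cmd] is still pending at the
   start of the round, whence the correction in [p]. *)
Definition inv_y ds sx xb sy v p cmd w := exists yb r rest p0,
  [/\ ctl w = control ds sx xb sy yb r, bits_val yb = v,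
      marks w = nseq p0 false ++ true :: rest, p = p0 + is_shift cmd &
      forall j, size ds <= j -> nth Undef (cells w) j = Undef].

Lemma marks_shift cmd M p0 rest : M = nseq p0 false ++ true :: rest ->
  exists rest', rcons (if is_shift cmd then belast false M else M) (is_shift cmd && last false M)
    = nseq (p0 + is_shift cmd) false ++ true :: rest'.
Proof.
move=> E; case: (is_shift cmd) => /=.
  by exists rest; rewrite -lastI addn1 E.
by exists (rcons rest false); rewrite addn0 E rcons_cat.
Qed.

Lemma y_round ds sx xb (sy : bool) v p cmd w :
  cmd <> RColumn -> (is_shift cmd -> sy) -> inv_y ds sx xb sy v p cmd w ->
  let o := round (rstart cmd) w in
  if ~~ sx && (0 < bits_val xb) then o.1 = inr Undef
  else if v is v'.+1 then
    if sy then o.1 = inl (rstart RShift) /\ inv_y ds sx xb sy v' p.+1 RShift o.2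
    else if p is p'.+1 then o.1 = inl (rstart RNop) /\ inv_y ds sx xb sy v' p' RNop o.2
    else o.1 = inr Undef
  else o.1 = inl (rstart RColumn) /\ inv_x ds 0 (bits_val xb) p o.2.
Proof.
move=> cN cS [yb [r [rest [p0 [cE vE mE pE aE]]]]].
have := round_spec cmd w; rewrite cE foldl_flag_control.
set ans := ans_pass _ _ _ _; move: ans => ans; cbv zeta.
have dE : turn_cmd cmd (sx, 0 < bits_val xb, sy, 0 < bits_val yb) ans =
  if ~~ sx && (0 < bits_val xb) then LHalt Undef else if v is v'.+1 then LDecY (~~ sy) else LEnc.
  by rewrite /turn_cmd vE; case: (cmd) cN => // _; case: (v).
have colE : (if cmd is RColumn then col_pass (Some false) (cells w) else cells w) = cells w.
  by case: (cmd) cN.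
rewrite {}dE {}colE; case: ifP => _; first by case=> -[b [e ->]].
have sz : size (control ds sx xb sy yb r) = size (cells w) by rewrite size_cells -cE size_ctl.
have encE d j : d <> LDecX ->
  nth Undef (rcons (enc_pass d false (control ds sx xb sy yb r) (cells w)) Undef) j = column ds 0 j.
  move=> dX; rewrite -(@nth_enc_control ds sx xb sy yb r d (cells w)) // nth_rcons.
  case: ltngtP => // ge; rewrite nth_default //; first exact: ltnW.
  by rewrite ge.
have colU j : size ds <= j -> column ds 0 j = Undef by rewrite /= ltnNge => ->.
case: v vE => [|v] vE.
  case=> -[b [e ->]] c2 a2 m2; split=> //.
  have [rest' mE'] := marks_shift cmd mE.
  exists sx, xb, sy, yb, r.+1, rest'; split=> //.
  - by rewrite c2 ctl_pass_enc control_pad.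
  - by rewrite m2 mE' pE.
  - by move=> j _; rewrite a2 encE.
have ypos : 0 < bits_val yb by rewrite vE.
have [yb' cE' vE'] := ctl_pass_decY ds sx xb sy r (~~ sy) ypos.
have newU w' : cells w' = rcons (enc_pass (LDecY (~~ sy)) false (control ds sx xb sy yb r) (cells w)) Undef ->
  forall j, size ds <= j -> nth Undef (cells w') j = Undef.
  by move=> -> j le; rewrite encE // colU.
case: sy cS aE sz encE newU {ypos} cE' cE => cS aE sz encE newU cE' cE.
  case=> -[b [e ->]] c2 a2 m2; split=> //.
  have [rest' mE'] := marks_shift cmd mE.
  exists yb', r.+1, rest', p; split=> //.
  - by rewrite c2 cE' control_pad.
  - by rewrite vE' vE.
  - by rewrite m2 mE' pE.
  - by rewrite addn1.
  - exact: newU.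
have sF : is_shift cmd = false by apply/negP => /cS.
case=> -[b [e ->]] c2 a2; rewrite sF /= mE => m2.
case: p pE => [|p]; rewrite sF addn0 => pE; first by rewrite -pE.
rewrite -pE /=; split=> //.
exists yb', r.+1, (rcons (rcons rest false) false), p; split=> //.
- by rewrite c2 cE' control_pad.
- by rewrite vE' vE.
- by rewrite m2 -pE /= !rcons_cat.
- by rewrite addn0.
- exact: newU.
Qed.

(** The bound counts [v] decrements of y, one encoding round, one round per column, and the round
    that reads the answer. *)
Lemma y_phase ds sx xb (sy : bool) v p cmd w :
  ~~ sx && (0 < bits_val xb) = false ->
  cmd <> RColumn -> (is_shift cmd -> sy) -> inv_y ds sx xb sy v p cmd w ->
  exists2 r, r <= v + bits_val xb + 2 & run_rounds r (rstart cmd) w =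
    Some (if sy then final ds (bits_val xb) (p + v)
          else if v <= p then final ds (bits_val xb) (p - v) else Undef).
Proof.
move=> hx; elim: v p cmd w => [|v IH] p cmd w cN cS.
  move=> /(y_round cN cS); rewrite /= hx => -[E /x_phase X].
  exists (bits_val xb).+2; first by lia.
  by rewrite (run_sweeps_inl _ E) X add0n addn0 subn0; case: sy {cS}.
move=> /(y_round cN cS); rewrite /= hx; case: sy IH cS => IH cS.
  case=> E /IH[//|//|r le R]; exists r.+1; first by lia.
  by rewrite (run_sweeps_inl _ E) R addSnnS.
case: p => [|p].
  by move=> E; exists 1; [lia | rewrite (run_sweeps_inr _ E)].
case=> E /IH[//|//|r le R]; exists r.+1; first by lia.
by rewrite (run_sweeps_inl _ E) R ltnS subSS.
Qed.

(** * The input word, correctness and running time *)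

Lemma bits_lsb_val f m : m <= f -> bits_val (rev (bits_lsb f m)) = m.
Proof.
elim: f m => [|f IH] m; first by rewrite leqn0 => /eqP->.
case: m => [//|m] le; rewrite [bits_lsb _ _]/= rev_cons bits_val_rcons IH; first by lia.
lia.
Qed.

Lemma nat_bin_bits m : exists2 bs, [seq Some c | c <- nat_bin m] = bits bs & bits_val bs = m.
Proof.
rewrite /nat_bin; case: eqP => [->|_]; first by exists [:: false].
exists (rev (bits_lsb m m)); last exact: bits_lsb_val.
by rewrite -map_rev -map_comp.
Qed.

Lemma int_bin_bits z : exists2 bs,
  [seq Some c | c <- int_bin z] = sgn (z < 0)%R ++ bits bs & bits_val bs = absz z.
Proof.
case: z => m; have [bs E V] := nat_bin_bits (absz m); first by exists bs.
by have [bs' E' V'] := nat_bin_bits m.+1; exists bs' => //=; rewrite E'.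
Qed.

Lemma ctl_init s : ctl (map init_cell s) = [seq Some c | c <- s].
Proof. by rewrite /ctl -map_comp. Qed.

Lemma inv_y_init ds x y : exists2 xb, bits_val xb = absz x &
  inv_y ds (x < 0)%R xb (y < 0)%R (absz y) (size ds) RNop (map init_cell (tm_input ds x y)).
Proof.
have [xb Ex Vx] := int_bin_bits x; have [yb Ey Vy] := int_bin_bits y.
exists xb => //; exists yb, 0, (marks (map init_cell (int_bin x ++ SSep :: int_bin y))), (size ds).
split=> //; last 1 first.
- move=> j _; rewrite /cells /tm_input -map_comp; have [lt|ge] := ltnP j (size (tm_input ds x y)).
    by rewrite (nth_map SD0).
  by rewrite nth_default // size_map.
- rewrite ctl_init /tm_input map_cat /= map_cat Ex /= Ey /control /digs cats0 -!catA -map_comp //.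
- rewrite /tm_input /marks map_cat [LHS]map_cat; congr (_ ++ _).
  rewrite -!map_comp -(size_rev ds); elim: (rev ds) => //= d s ->; congr (_ :: _).
  by case: d => [[|[|[|m]]] lt].
- by rewrite addn0.
Qed.

Lemma cqca_run ds x y : exists2 st, cinf ds x y st &
  exists2 r, r <= absz x + absz y + 2 &
    run_rounds r (rstart RNop) (map init_cell (tm_input ds x y)) = Some st.
Proof.
have [xb Vx I] := inv_y_init ds x y.
case hx : (~~ (x < 0)%R && (0 < bits_val xb)).
  exists Undef; first by apply: cinf_out; move: hx; rewrite Vx; lia.
  exists 1; first by lia.
  have := y_round (cmd := RNop) _ _ I; rewrite hx => E.
  by apply: run_sweeps_inr; apply: E.
have [//|//|r le R] := y_phase hx _ _ I.
rewrite Vx in hx le R; eexists; last by exists r; [lia | exact: R].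
have xE : x = (- (absz x)%:Z)%R by lia.
case: ifP => hy.
  by rewrite {1}xE {1}(_ : y = (size ds)%:Z - (size ds + absz y)%N%:Z)%R; [exact: cinf_in | lia].
case: leqP => hn; last by apply: cinf_out; lia.
by rewrite {1}xE {1}(_ : y = (size ds)%:Z - (size ds - absz y)%N%:Z)%R; [exact: cinf_in | lia].
Qed.

Lemma cqca_in_P (R : realType) (K : R) : (1 <= K)%R -> in_P K.
Proof.
(* With N the input length, there are at most (2k+2)N rounds of at most (4k+10)N steps each. Since N
   is at least 2, D is at most N^D, which turns the time D N^2 into a pure power with exponent D +
   2. *)
move=> K1; pose k := Num.bound K; pose D := (2 * k + 2) * (4 * k + 10).
have hk : (K < k%:R)%R by apply: archi_boundP; apply: le_trans K1.
exists cqcaTM, (D + 2) => ds x y [vx vy].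
have [st hst [r hr hrun]] := cqca_run ds x y.
have [t ht hout] := sweepTM_output hrun.
exists t, st; split=> //; apply: leq_trans ht _; apply: leq_trans (leq_addr _ _).
set N := size (tm_input ds x y).
have hN : size ds + 2 <= N by rewrite /N /tm_input !size_cat /= !size_cat size_map size_rev /=; lia.
have bound (z : int) : ((absz z)%:R <= K * (size ds)%:R)%R -> absz z <= k * size ds.
  move=> h; rewrite -(ler_nat R) natrM; apply: le_trans h _.
  by apply: ler_wpM2r => //; apply: ltW.
have hr2 : r <= (2 * k + 2) * N.
  by apply: leq_trans hr _; move: (bound _ vx) (bound _ vy); nia.
have hrN : (r + N).+1.*2 <= (4 * k + 10) * N by nia.
rewrite addnC in hrN.
apply: (@leq_trans (D * N ^ 2)).
  apply: leq_trans (leq_mul hr2 hrN) _; rewrite /D; apply: eq_leq; lia.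
rewrite expnD leq_mul2r; apply/orP; right.
apply: leq_trans (ltnW (ltn_expl D (isT : 1 < 2))) _.
by case: (D) => // D'; rewrite leq_exp2r //; lia.
Qed.

Theorem mainTheorem6 (R : realType) (K : R) (hK : (1 <= K)%R) :
  (forall (alpha : seq 'I_3) (x y : int), exists st : sigma, cinf alpha x y st) /\
  in_P K /\ ~ in_AC0 K.
Proof.
split; first exact: cinf_ex.
by split; [exact: cqca_in_P | exact: not_in_AC0].
Qed.
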